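(* Let $P$ be a full-dimensional convex polytope in $\mathbb{R}^d$ and let $f:\mathbb{R}^d\to\mathbb{C}$ be continuous on $P$ and equal to $0$ outside $P$. Then $$\sum_{x\in\mathbb{Z}^d}f(x)\,\omega_P(x) = \lim_{\epsilon\to0^+}\sum_{x\in\mathbb{Z}^d}(f*\mathcal{G}_\epsilon)(x).$$
   Context: $\mathcal{G}_\epsilon(x) := \epsilon^{-d/2}e^{-\pi\|x\|^2/\epsilon}$ for $\epsilon>0$; $*$ is convolution; $\omega_P(x) := \lim_{r\to0^+}\frac{\mathrm{vol}(B(x,r)\cap P)}{\mathrm{vol}(B(x,r))}$. The left-hand side is a finite sum since $P$ is compact. *)

(* Defs.v *)
From HB Require Import structures.
From mathcomp Require Import all_boot all_order all_algebra.
From mathcomp Require Import all_classical all_reals all_analysis.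
From mathcomp Require Import complex.
Export Order.TTheory GRing.Theory Num.Theory.
Export numFieldTopology.Exports numFieldNormedType.Exports.

Set Implicit Arguments.
Unset Strict Implicit.
Unset Printing Implicit Defensive.

Local Open Scope classical_set_scope.
Local Open Scope ring_scope.

Section Defs.
Variable R : realType.

(* The complex numbers, with the topology of the modulus |z|. *)
Definition Cplx := (R[i])^o.

Definition sqnorm {d : nat} (x : 'rV[R]_d) : R := \sum_(i < d) x ord0 i ^+ 2.

Definition eball {d : nat} (x : 'rV[R]_d) (r : R) : set 'rV[R]_d :=
  [set y | sqnorm (y - x) < r ^+ 2].

Definition conv_hull {d : nat} (V : seq 'rV[R]_d) : set 'rV[R]_d :=
  [set x | exists lam : 'I_(size V) -> R,
     [/\ forall i, 0 <= lam i, \sum_(i < size V) lam i = 1 &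
         x = \sum_(i < size V) lam i *: V`_i]].

Definition full_dim_polytope {d : nat} (P : set 'rV[R]_d) : Prop :=
  exists V : seq 'rV[R]_d, P = conv_hull V /\ interior P !=set0.

Definition vcons {n : nat} (t : R) (v : 'rV[R]_n) : 'rV[R]_n.+1 :=
  \row_(j < n.+1) match unlift ord0 j with Some k => v ord0 k | None => t end.

(* d-dimensional Lebesgue integral of a real function, as an iterated
   Lebesgue integral over the coordinates (Fubini) *)
Fixpoint iRint (n : nat) : ('rV[R]_n -> R) -> R :=
  match n return ('rV[R]_n -> R) -> R with
  | 0 => fun f => f 0
  | n'.+1 => fun f =>
      Rintegral (@lebesgue_measure R) [set: R] (fun t => iRint (fun v => f (vcons t v)))
  end.

Fixpoint ieint (n : nat) : ('rV[R]_n -> \bar R) -> \bar R :=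
  match n return ('rV[R]_n -> \bar R) -> \bar R with
  | 0 => fun f => f 0
  | n'.+1 => fun f =>
      (\int[@lebesgue_measure R]_t ieint (fun v => f (vcons t v)))%E
  end.

Definition vol {d : nat} (A : set 'rV[R]_d) : \bar R :=
  ieint (fun x => (\1_A x)%:E).

Definition omega {d : nat} (P : set 'rV[R]_d) (x : 'rV[R]_d) : R :=
  lim ((fine (vol (eball x r `&` P)) / fine (vol (eball x r))) @[r --> 0^'+]).

Definition gauss {d : nat} (eps : R) (x : 'rV[R]_d) : R :=
  eps `^ (- (d%:R / 2)) * expR (- (pi * sqnorm x) / eps).

Definition conv_gauss {d : nat} (f : 'rV[R]_d -> Cplx) (eps : R) (x : 'rV[R]_d)
  : Cplx :=
  (iRint (fun y => complex.Re (f y) * gauss eps (x - y)) +i*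
   iRint (fun y => complex.Im (f y) * gauss eps (x - y)))%C.

Definition latsum_box {d : nat} (g : 'rV[R]_d -> Cplx) (N : nat) : Cplx :=
  \sum_(k : {ffun 'I_d -> 'I_(N.*2.+1)})
     g (\row_(i < d) (((k i : nat)%:Z - N%:Z)%:~R : R)).

Definition latsum {d : nat} (g : 'rV[R]_d -> Cplx) : Cplx :=
  lim (latsum_box g N @[N --> \oo]).

End Defs.

(* Main.v *)
(** Write y = x + sqrt(eps) z in (f * G_eps)(x): it becomes the integral of
f(x + sqrt(eps) z) against the standard Gaussian exp(-pi |z|^2). As P is
convex and closed, f(x + r z) tends, as r -> 0+, to f(x) times the indicator
of the cone C of feasible directions of P at x, for every z; by dominated
convergence the integral tends to f(x) times the Gaussian mass of C. The same
argument with the unit ball instead of the Gaussian shows that omega_P(x) is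
the fraction of the unit ball lying in C, and both numbers agree because each
radial measure gives a cone the same fraction of its total mass. Finally |f|
is at most a constant times the indicator of a cube, so |(f * G_eps)(x)| is
bounded by a product over the coordinates of one-dimensional Gaussian masses,
which is O(prod 1/(|x_i|+1)(|x_i|+2)) uniformly in eps <= 1; the sum over the
lattice and the limit can therefore be exchanged. *)
Require Import Defs.
From HB Require Import structures.
From mathcomp Require Import all_boot all_order all_algebra finmap.
From mathcomp Require Import all_classical all_reals all_analysis.
From mathcomp Require Import complex measurable_realfun.
From mathcomp Require Import ring lra zify.
Import Order.TTheory GRing.Theory Num.Theory.
Import numFieldTopology.Exports numFieldNormedType.Exports.
Local Open Scope classical_set_scope.
Local Open Scope ring_scope.
Set Implicit Arguments.
Unset Strict Implicit.
Unset Printing Implicit Defensive.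

(** * Lebesgue measure on row vectors *)

(** Volume and convolution are given as iterated one-dimensional integrals, whereas substitution and
    dominated convergence need a measure on the whole space. [leb n] is therefore built by the same
    recursion on coordinates, and the iterated integrals are identified with integrals against it.
    For [iRint] every slice, not almost every one, must have a finite integral; domination by the
    indicator of a cube provides this. The comparison of the two fractions of a cone avoids polar
    coordinates: the law of |z|^2 on the cone and its law on the whole space are measures on the
    line with proportional values on rays, hence proportional on all Borel sets. Since [latsum] is a
    [lim] over boxes, convergence must be established before its value can be used; the summable
    majorant yields convergence as well as tails that are uniform in eps. All this is done for real
    functions; complex values enter at the end through real and imaginary parts. *)

Section EuclideanMeasure.
Variable R : realType.
Notation lebR := (@lebesgue_measure R).

Definition coordinate_sets (n : nat) : set (set 'rV[R]_n) :=
  [set A | exists i : 'I_n, exists2 B : set R, measurable B &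
    A = (fun x : 'rV[R]_n => x ord0 i) @^-1` B].

(** A copy of ['rV[R]_n] carrying the product sigma-algebra, so that a map into it is measurable as
    soon as its coordinates are. The casts back to ['rV[R]_n] recover the matrix operations. *)
Definition rvec (n : nat) := g_sigma_algebraType (@coordinate_sets n).

Lemma measurable_coord n (i : 'I_n) :
  measurable_fun [set: rvec n] (fun x : rvec n => (x : 'rV[R]_n) ord0 i).
Proof.
by move=> _ B mB; rewrite setTI; apply: sub_sigma_algebra; exists i; exists B.
Qed.

Lemma measurable_rvecP d (T : measurableType d) n (h : T -> rvec n) :
  (forall i, measurable_fun setT (fun t => (h t : 'rV[R]_n) ord0 i)) ->
  measurable_fun setT h.
Proof.
move=> mh; apply: (@measurability _ _ T (rvec n) setT h (@coordinate_sets n)) => //.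
move=> _ [_ [i [B mB ->] <-]].
by rewrite setTI; have := mh i measurableT B mB; rewrite setTI.
Qed.

Definition consp n (p : measurableTypeR R * rvec n) : rvec n.+1 :=
  vcons p.1 p.2.

Lemma vcons0 n (t : R) (v : 'rV[R]_n) : vcons t v ord0 ord0 = t.
Proof. by rewrite mxE unlift_none. Qed.

Lemma vcons_lift n (t : R) (v : 'rV[R]_n) i :
  vcons t v ord0 (lift ord0 i) = v ord0 i.
Proof. by rewrite mxE liftK. Qed.

Lemma measurable_consp n : measurable_fun setT (@consp n).
Proof.
apply: measurable_rvecP => i; rewrite /consp.
case: (unliftP ord0 i) => [j|] ->.
  under eq_fun do rewrite vcons_lift.
  exact: (measurableT_comp (@measurable_coord n j)).
under eq_fun do rewrite vcons0.
exact: measurable_fst.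
Qed.

Section Step.
Variable n : nat.
Variable m : {sigma_finite_measure set (rvec n) -> \bar R}.

(** The first coordinate is outermost, as in [iRint] and [ieint]: one step of those recursions is
    one application of Fubini or Tonelli. *)
Definition cons_measure : set (rvec n.+1) -> \bar R :=
  pushforward (lebR \x m)%E (@consp n).


Let pre_measurable A : measurable A -> measurable (@consp n @^-1` A).
Proof. by move=> mA; rewrite -[X in measurable X]setTI; exact: measurable_consp. Qed.

Let cons_measure0 : cons_measure set0 = 0.
Proof. by rewrite /cons_measure /pushforward preimage_set0 measure0. Qed.

Let cons_measure_ge0 A : (0 <= cons_measure A)%E.
Proof. exact: (measure_ge0 (lebR \x m)%E). Qed.

Let cons_measure_sigma_additive : semi_sigma_additive cons_measure.
Proof.
move=> F mF tF mUF; rewrite /cons_measure /pushforward preimage_bigcup.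
apply: measure_semi_sigma_additive.
- by move=> i; exact: pre_measurable.
- apply/trivIsetP => /= i j _ _ ij; rewrite -preimage_setI.
  by move/trivIsetP : tF => /(_ _ _ _ _ ij) ->//; rewrite preimage_set0.
- by rewrite -preimage_bigcup; exact: pre_measurable.
Qed.

HB.instance Definition _ := isMeasure.Build _ _ _ cons_measure
  cons_measure0 cons_measure_ge0 cons_measure_sigma_additive.

(** Serves to prove sigma-finiteness, which the recursion must pass on: preimages under this inverse
    of [consp] carry rectangles of finite measure to [rvec n.+1] and are measurable at once. *)
Definition uncons (x : rvec n.+1) : measurableTypeR R * rvec n :=
  ((x : 'rV[R]_n.+1) ord0 ord0, \row_j (x : 'rV[R]_n.+1) ord0 (lift ord0 j)).

Lemma measurable_uncons : measurable_fun setT uncons.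
Proof.
apply: measurable_fun_pair; first exact: measurable_coord.
apply: measurable_rvecP => i.
under eq_fun do rewrite mxE.
exact: measurable_coord.
Qed.

Lemma consK : cancel (@consp n) uncons.
Proof.
move=> [t v]; congr (_, _); first exact: vcons0.
by apply/rowP => j; rewrite mxE vcons_lift.
Qed.

Let cons_measure_sigma_finite : sigma_finite setT cons_measure.
Proof.
have /sigma_finiteP[F [FT ndF Foo]] := sigma_finiteT lebR.
have /sigma_finiteP[G [GT ndG Goo]] := sigma_finiteT m.
exists (fun i => uncons @^-1` (F i `*` G i)).
  apply/esym; rewrite -subTset => x _.
  have [i _ Fi] : (\bigcup_i F i) (uncons x).1 by rewrite -FT.
  have [j _ Gj] : (\bigcup_i G i) (uncons x).2 by rewrite -GT.
  exists (maxn i j) => //; split.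
  - by move: Fi; exact/subsetPset/ndF/leq_maxl.
  - by move: Gj; exact/subsetPset/ndG/leq_maxr.
move=> i; have [mF mFoo] := Foo i; have [mG mGoo] := Goo i; split.
  by rewrite -[X in measurable X]setTI; apply: measurable_uncons => //; exact: measurableX.
rewrite /cons_measure /pushforward -comp_preimage.
rewrite (_ : uncons \o _ = id); last exact/funext/consK.
by rewrite preimage_id product_measure1E// lte_mul_pinfty// ge0_fin_numE.
Qed.

HB.instance Definition _ := Measure_isSigmaFinite.Build _ _ _ cons_measure
  cons_measure_sigma_finite.

End Step.

Fixpoint leb (n : nat) : {sigma_finite_measure set (rvec n) -> \bar R} :=
  match n with
  | 0 => @dirac _ (rvec 0) (0 : 'rV[R]_0) R
  | n'.+1 => cons_measure (leb n')
  end.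

Lemma leb_ge0_integralS n (h : rvec n.+1 -> \bar R) :
  measurable_fun setT h -> (forall x, 0 <= h x)%E ->
  (\int[leb n.+1]_x h x = \int[lebR]_t \int[leb n]_v h (vcons t v))%E.
Proof.
move=> mh h0; rewrite [LHS](@ge0_integral_pushforward _ _ _ _ _ _ (@measurable_consp n) _ setT)//.
have mhc : measurable_fun setT (h \o @consp n).
  by apply: measurableT_comp => //; exact: measurable_consp.
by rewrite preimage_setT (fubini_tonelli1 _ mhc)// => x; exact: h0.
Qed.

Lemma leb_integralS n (h : rvec n.+1 -> \bar R) :
  (leb n.+1).-integrable setT h ->
  (\int[leb n.+1]_x h x = \int[lebR]_t \int[leb n]_v h (vcons t v))%E.
Proof.
move=> ih.
have ih' : (lebR \x leb n)%E.-integrable setT (h \o @consp n).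
  move/integrableP : ih => [mh ih]; apply/integrableP; split.
    by apply: measurableT_comp => //; exact: measurable_consp.
  move: ih; rewrite (@ge0_integral_pushforward _ _ _ _ _ _ (@measurable_consp n) _ setT)//.
  exact: measurableT_comp.
rewrite [LHS](@integral_pushforward _ _ _ _ _ _ (@measurable_consp n) _ setT)//.
  by rewrite preimage_setT -integral12_prod_meas1.
by case/integrableP: ih.
Qed.

Lemma measurable_vcons n t : measurable_fun setT (fun v : rvec n => vcons t v : rvec n.+1).
Proof.
have := measurableT_comp (@measurable_consp n) (@measurable_pair1 _ _ (measurableTypeR R) (rvec n) t).
exact.
Qed.

Lemma ieintE n (h : rvec n -> \bar R) :
  measurable_fun setT h -> (forall x, 0 <= h x)%E ->
  ieint h = (\int[leb n]_x h x)%E.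
Proof.
elim: n h => [|n IH] h mh h0 /=; first by rewrite integral_dirac// diracT mul1e.
rewrite leb_ge0_integralS//; apply: eq_integral => t _.
rewrite IH//.
exact: (measurableT_comp mh (measurable_vcons t)).
Qed.

Lemma leb_indic n (A : set (rvec n)) : measurable A ->
  leb n A = (\int[leb n]_x (\1_A x)%:E)%E.
Proof. by move=> mA; rewrite integral_indic// setIT. Qed.

Lemma volE n (A : set 'rV[R]_n) : measurable (A : set (rvec n)) ->
  vol A = leb n A.
Proof.
move=> mA; rewrite /vol (@ieintE n)// ?leb_indic//.
by apply/measurable_EFinP; exact: measurable_indic.
Qed.

Lemma ge0_integral_prod n (phi : 'I_n -> R -> R) :
  (forall i, measurable_fun [set: measurableTypeR R] (phi i)) -> (forall i t, 0 <= phi i t) ->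
  (\int[leb n]_x (\prod_(i < n) phi i ((x : 'rV[R]_n) ord0 i))%:E =
   \prod_(i < n) \int[lebR]_t (phi i t)%:E)%E.
Proof.
elim: n phi => [|n IH] phi mphi phi0.
  under eq_integral do rewrite big_ord0.
  by rewrite big_ord0 integral_dirac// diracT mul1e.
have mprod k (psi : 'I_k -> R -> R) : (forall i, measurable_fun [set: measurableTypeR R] (psi i)) ->
    measurable_fun setT (fun x : rvec k => (\prod_(i < k) psi i ((x : 'rV[R]_k) ord0 i))%:E).
  move=> mpsi; apply/measurable_EFinP; apply: measurable_prod => i _.
  exact: (measurableT_comp (mpsi i) (@measurable_coord k i)).
rewrite leb_ge0_integralS//; first last.
  - by move=> x; rewrite lee_fin prodr_ge0.
  - exact: mprod.
under eq_integral => t _.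
  under eq_integral => v _.
    rewrite big_ord_recl vcons0 EFinM.
    under eq_bigr do rewrite vcons_lift.
    over.
  rewrite ge0_integralZl//; first last.
  - by rewrite lee_fin.
  - by move=> v _; rewrite lee_fin prodr_ge0.
  - exact: (mprod n (fun i => phi (lift ord0 i))).
  rewrite (IH (fun i => phi (lift ord0 i)))//.
  over.
rewrite ge0_integralZr//.
- by rewrite big_ord_recl.
- by apply/measurable_EFinP.
- by move=> t _; rewrite lee_fin.
- by apply: prode_ge0 => i _; apply: integral_ge0 => t _; rewrite lee_fin.
Qed.

End EuclideanMeasure.

(** * Affine change of variables *)

Section AffineChange.
Variable R : realType.
Notation lebR := (@lebesgue_measure R).

Lemma lebR_affine (a s : R) (h : measurableTypeR R -> \bar R) : 0 < s ->
  measurable_fun setT h -> (forall t, 0 <= h t)%E ->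
  (\int[lebR]_t h (a + s * t)%R = s^-1%:E * \int[lebR]_t h t)%E.
Proof.
move=> s0 mh h0.
pose phi (t : measurableTypeR R) : measurableTypeR R := a + s * t.
have mphi : measurable_fun setT phi.
  by apply: measurable_funD => //; exact: measurable_funM.
pose nu := measure_function_pushforward__canonical__measure_function_Measure lebR mphi.
(* The push-forward of Lebesgue measure by [phi], multiplied by s, gives ]u, v] the mass s * ((v -
   a) / s - (u - a) / s) = v - u, so uniqueness of Lebesgue measure identifies the two. *)
have nuE A : measurable A -> lebR A = mscale (NngNum (ltW s0)) nu A.
  apply: lebesgue_measure_unique => _ [[u v] _ <-] /=.
  rewrite /mscale /= /pushforward (_ : phi @^-1` _ = `](u - a) / s, (v - a) / s]%classic).
    rewrite !lebesgue_measure_itv/= !lte_fin ltr_pM2r ?invr_gt0// ltrD2r.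
    case: ifP => _; last by rewrite mule0.
    by rewrite -!EFinD -EFinM; congr EFin; field; rewrite gt_eqF.
  apply/seteqP; split => t; rewrite /phi /= !in_itv/= ltr_pdivrMr// ler_pdivlMr//;
   by rewrite ltrBlDl lerBrDl mulrC.
rewrite [in RHS](eq_measure_integral (mscale (NngNum (ltW s0)) nu)); last by move=> A mA _; exact: nuE.
rewrite ge0_integral_mscale//= muleA -EFinM mulVf ?gt_eqF// mul1e.
by rewrite (ge0_integral_pushforward mphi)// preimage_setT.
Qed.

Lemma measurable_affine n (a : 'rV[R]_n) (s : R) :
  measurable_fun setT (fun z : rvec R n => (a + s *: (z : 'rV[R]_n)) : rvec R n).
Proof.
apply: measurable_rvecP => i.
under eq_fun do rewrite !mxE.
apply: measurable_funD => //; apply: measurable_funM => //.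
exact: measurable_coord.
Qed.

Lemma vcons_affine n (a : 'rV[R]_n.+1) (s t : R) (v : 'rV[R]_n) :
  a + s *: vcons t v =
  vcons (a ord0 ord0 + s * t) ((\row_j a ord0 (lift ord0 j)) + s *: v).
Proof.
apply/rowP => j; rewrite !mxE; case: unliftP => [k|] -> //=.
by rewrite !mxE.
Qed.

Lemma ge0_leb_affine n (a : 'rV[R]_n) (s : R) (h : rvec R n -> \bar R) : 0 < s ->
  measurable_fun setT h -> (forall t, 0 <= h t)%E ->
  (\int[leb R n]_z h (a + s *: (z : 'rV[R]_n))%R = (s ^- n)%:E * \int[leb R n]_z h z)%E.
Proof.
move=> s0; elim: n a h => [|n IH] a h mh h0.
  rewrite !integral_dirac// ?diracT ?mul1e ?expr0 ?invr1 ?mul1e; last first.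
    exact: (measurableT_comp mh (measurable_affine a s)).
  by congr h; apply/rowP => -[].
rewrite !leb_ge0_integralS//; last first.
  exact: (measurableT_comp mh (measurable_affine a s)).
have mhv t : measurable_fun setT (fun v : rvec R n => h (vcons t v)).
  exact: (measurableT_comp mh (measurable_vcons t)).
under eq_integral => t _.
  under eq_integral do rewrite vcons_affine.
  rewrite (IH _ (fun v => h (vcons (a ord0 ord0 + s * t) v)))//.
  over.
have mH : measurable_fun setT (fun t : measurableTypeR R => \int[leb R n]_v h (vcons t v))%E.
  apply: (@measurable_fun_fubini_tonelli_F _ _ _ _ _ (leb R n) (h \o @consp R n)).
  - by apply: measurableT_comp => //; exact: measurable_consp.
  - by move=> x; exact: h0.
have H0 t : (0 <= \int[leb R n]_v h (vcons t v))%E by apply: integral_ge0 => v _; exact: h0.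
have sn0 : 0 <= s ^- n by rewrite invr_ge0 exprn_ge0// ltW.
rewrite (@lebR_affine (a ord0 ord0) s (fun t => (s ^- n)%:E * \int[leb R n]_v h (vcons t v)))%E//.
- rewrite ge0_integralZl// muleA -EFinM; congr (_%:E * _)%E.
  by rewrite exprS invfM mulrC.
- exact: measurable_funeM.
- by move=> t; rewrite mule_ge0.
Qed.

End AffineChange.

(** * Functions dominated by the indicator of a cube *)

Section BoxBounded.
Variable R : realType.
Notation lebR := (@lebesgue_measure R).

Definition box_fun n (M : R) (x : 'rV[R]_n) : R :=
  \prod_(i < n) \1_(`[- M, M]%classic : set R) (x ord0 i).

(** Unlike integrability, this survives freezing the first coordinate at any value. In [iRintE] it
    makes every slice integral finite, so that the [fine] hidden in [Rintegral] loses nothing. *)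
Definition box_bounded n (h : 'rV[R]_n -> R) : Prop :=
  exists C M : R, [/\ 0 <= C, 0 <= M & forall x, `|h x| <= C * box_fun M x].

Lemma box_fun_ge0 n M (x : 'rV[R]_n) : 0 <= box_fun M x.
Proof. by apply: prodr_ge0 => i _; rewrite indicE. Qed.

Lemma box_fun_le1 n M (x : 'rV[R]_n) : box_fun M x <= 1.
Proof.
by apply: prodr_ile1 => i; rewrite indicE ler0n lern1; case: (_ \in _).
Qed.

Lemma measurable_box_fun n M : measurable_fun setT (box_fun M : rvec R n -> R).
Proof.
apply: measurable_prod => i _.
have mI : measurable_fun setT (\1_(`[- M, M]%classic) : measurableTypeR R -> R).
  exact: measurable_indic.
exact: (measurableT_comp mI (@measurable_coord R n i)).
Qed.

Lemma integral_box_fun n (M : R) : 0 <= M ->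
  (\int[leb R n]_x (box_fun M x)%:E = ((M *+ 2) ^+ n)%:E)%E.
Proof.
move=> M0; rewrite /box_fun.
rewrite (@ge0_integral_prod R n (fun _ => \1_(`[- M, M]%classic : set R)))//.
- under eq_bigr => i _.
    rewrite integral_indic//= setIT lebesgue_measure_itv/= lte_fin.
    rewrite (_ : (if _ then _ else _) = (M *+ 2)%:E); last first.
      case: ltP => [_|]; first by rewrite -EFinB opprK -mulr2n.
      move=> MM; have -> : M = 0 by lra.
      by rewrite mul0rn.
    over.
  by rewrite prodEFin prodr_const card_ord.
Qed.

Lemma box_bounded_integrable n (h : 'rV[R]_n -> R) :
  measurable_fun setT (h : rvec R n -> R) -> box_bounded h ->
  (leb R n).-integrable setT (fun x => (h x)%:E).
Proof.
move=> mh [C [M [C0 M0 hCM]]].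
apply: (@le_integrable _ _ _ _ _ _ _ (fun x : rvec R n => (C * box_fun M x)%:E)) => //.
- exact/measurable_EFinP.
- by move=> x _ /=; rewrite lee_fin (le_trans (hCM x))// ler_norm.
apply/integrableP; split.
  by apply/measurable_EFinP; apply: measurable_funM => //; exact: measurable_box_fun.
under eq_integral => x _ do rewrite gee0_abs ?lee_fin ?mulr_ge0 ?box_fun_ge0// EFinM.
rewrite ge0_integralZl//; first last.
- by move=> x _; rewrite lee_fin box_fun_ge0.
- by apply/measurable_EFinP; exact: measurable_box_fun.
by rewrite integral_box_fun// -EFinM ltry.
Qed.

Lemma box_bounded_vcons n (h : 'rV[R]_n.+1 -> R) t :
  box_bounded h -> box_bounded (fun v => h (vcons t v)).
Proof.
move=> [C [M [C0 M0 hCM]]]; exists C, M; split => // v.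
apply: (le_trans (hCM _)); rewrite ler_wpM2l//.
rewrite {1}/box_fun big_ord_recl vcons0.
under eq_bigr do rewrite vcons_lift.
rewrite ler_piMl ?box_fun_ge0// indicE.
Qed.

Lemma iRintE n (h : 'rV[R]_n -> R) :
  measurable_fun setT (h : rvec R n -> R) -> box_bounded h ->
  iRint h = fine (\int[leb R n]_x (h x)%:E)%E.
Proof.
elim: n h => [|n IH] h mh bh.
  by rewrite /= integral_dirac// ?diracT ?mul1e//; exact/measurable_EFinP.
rewrite /= /Rintegral leb_integralS; last exact: box_bounded_integrable.
congr fine; apply: eq_integral => t _.
have mht : measurable_fun setT (fun v : rvec R n => h (vcons t v)).
  exact: (measurableT_comp mh (measurable_vcons t)).
have bht := box_bounded_vcons t bh.
rewrite IH// fineK//.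
by apply: integrable_fin_num => //; exact: (box_bounded_integrable mht bht).
Qed.

End BoxBounded.

(** * Continuous functions on compact convex sets *)

Section Compact.
Variable R : realType.

(** Balls of ['rV[R]_n] are those of the sup norm, hence finite intersections of coordinate slabs.
    This ties the topology to the sigma-algebra of [rvec]. *)
Lemma measurable_rvec_ball n (p : 'rV[R]_n) e : 0 < e ->
  measurable (ball p e : set (rvec R n)).
Proof.
move=> e0; rewrite (_ : ball p e = \bigcap_(i in [set: 'I_n])
   ((fun x : 'rV[R]_n => x ord0 i) @^-1` ball (p ord0 i) e)); last first.
  apply/seteqP; split => [x px i _ | x px].
    by have := px; rewrite /ball/= => -[_ /(_ ord0 i)].
  by split => // i j; rewrite (ord1 i); exact: (px j I).
apply: fin_bigcap_measurable => // i _.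
rewrite -[X in measurable X]setTI; apply: measurable_coord => //.
exact: measurable_ball.
Qed.

(* K is the intersection over m of finite unions of balls of radius 1/(m+1) centred on K. *)
Lemma compact_measurable n (K : set 'rV[R]_n) :
  compact K -> measurable (K : set (rvec R n)).
Proof.
move=> cK.
have /choice[U UP] (m : nat) : exists U : set 'rV[R]_n,
    [/\ measurable (U : set (rvec R n)), K `<=` U &
     forall x, U x -> exists2 p, K p & ball p (m.+1%:R^-1 : R) x].
  move: (cK); rewrite compact_cover => /(_ _ K (fun p => (ball p (m.+1%:R^-1 : R))°)).
  case=> [p _|p Kp|D DK KD].
  - exact: open_interior.
  - by exists p => //; apply: nbhsx_ballx; rewrite invr_gt0.
  exists (\bigcup_(p in [set` D]) ball p (m.+1%:R^-1 : R)); split.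
  - by apply: fin_bigcup_measurable => // p _; apply: measurable_rvec_ball; rewrite invr_gt0.
  - by apply: (subset_trans KD) => x [p Dp] /interior_subset px; exists p.
  - by move=> x [p Dp px]; exists p => //; have := DK p Dp; rewrite inE.
rewrite (_ : K = \bigcap_m U m).
  by apply: bigcapT_measurable => m; have [] := UP m.
apply/seteqP; split => [x Kx m _|x Ux]; first by have [_ + _] := UP m; exact.
have cl : closed K by apply: compact_closed.
apply: cl => B /nbhs_ballP[e /= e0 Be].
have [m me] : exists m : nat, m.+1%:R^-1 < e.
  have := near_infty_natSinv_lt (PosNum e0) => -[m _ /(_ m (leqnn m))] /= h.
  by exists m.
have [_ _ /(_ _ (Ux m I))[p Kp px]] := UP m.
by exists p; split => //; apply: Be; apply: ball_sym; apply: le_ball px; exact: ltW.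
Qed.

Lemma within_continuous_cvg (T U : topologicalType) (K : set T) (f : T -> U) x :
  {within K, continuous f} -> K x -> f @ within K (nbhs x) --> f x.
Proof.
by move=> fc Kx; have := fc x; rewrite /continuous_at nbhs_subspace_in.
Qed.

(** By continuity within K, the part of K where f >= a is closed, hence compact and measurable; the
    rays [a, +oo[ generate the Borel sets. *)
Lemma compact_measurable_fun n (K : set 'rV[R]_n) (f : 'rV[R]_n -> R) :
  compact K -> {within K, continuous f} ->
  measurable_fun (K : set (rvec R n)) (f : rvec R n -> R).
Proof.
move=> cK fc.
have clK : closed K by apply: compact_closed.
apply: (@measurability _ _ (rvec R n) (measurableTypeR R) K f _ (RGenCInfty.measurableE R)) => _ [_ [a ->] <-].
apply: compact_measurable.
apply: (subclosed_compact _ cK); last by move=> x [].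
move=> x clx.
have Kx : K x by apply: clK => B /clx [y [[Ky _] By]]; exists y.
split => //=; rewrite in_itv/= andbT leNgt; apply/negP => fxa.
have := within_continuous_cvg fc Kx.
move=> /(_ [set t | t < a]) /=.
have /[swap] /[apply] : nbhs (f x) [set t | t < a] by exact: lt_nbhsl.
rewrite /within/= => /clx [y [[Ky]]] /=.
by rewrite in_itv/= andbT => ay /(_ Ky); rewrite /= ltNge ay.
Qed.

Lemma box_funE n (M : R) (x : 'rV[R]_n) :
  (forall i, `|x ord0 i| <= M) -> box_fun M x = 1.
Proof.
move=> xM; apply: big1 => i _; rewrite indicE mem_set//=.
by rewrite in_itv/= -ler_norml.
Qed.

Section Extension.
Variables (n : nat) (K : set 'rV[R]_n) (f : 'rV[R]_n -> R).
Hypotheses (cK : compact K) (fc : {within K, continuous f})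
  (f0 : forall x, ~ K x -> f x = 0).

Lemma measurable_extension : measurable_fun setT (f : rvec R n -> R).
Proof.
have -> : f = f \_ K.
  apply/funext => x; rewrite patchE; case: ifPn => // /negP; rewrite inE => Kx.
  exact: f0.
have := compact_measurable_fun cK fc.
by move/(measurable_restrictT _ (compact_measurable cK)).
Qed.

Lemma box_bounded_extension : box_bounded f.
Proof.
(* Every real above [C] is a bound; [|C| + 1] is one that is also nonnegative, as [box_bounded]
   asks. The same choice is made for [M]. *)
have /compact_bounded[C [_ /(_ (`|C| + 1))]] : compact (f @` K).
  exact: continuous_compact.
rewrite (le_lt_trans (ler_norm C)) ?ltrDl// => /(_ isT) fC.
have /compact_bounded[M [_ /(_ (`|M| + 1))]] := cK.
rewrite (le_lt_trans (ler_norm M)) ?ltrDl// => /(_ isT) KM.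
exists (`|C| + 1), (`|M| + 1); split; rewrite ?addr_ge0// => x.
have [Kx|Kx] := pselect (K x); last by rewrite f0// normr0 mulr_ge0 ?addr_ge0 ?box_fun_ge0.
rewrite box_funE ?mulr1.
  by apply: fC; exists x.
move=> i; apply: le_trans (KM x Kx).
rewrite /Num.norm/= mx_normrE.
exact: (@le_bigmax _ _ _ 0 (fun i : 'I_1 * 'I_n => `|x i.1 i.2|) (ord0, i)).
Qed.

End Extension.

(** The hull is the image, under the continuous map [F], of the standard simplex [S], a closed part
    of a compact cube of weights. *)
Lemma compact_conv_hull n (V : seq 'rV[R]_n) : compact (conv_hull V).
Proof.
pose S := [set lam : 'rV[R]_(size V) | (forall i, `[0, 1]%classic (lam ord0 i)) /\
   \sum_(i < size V) lam ord0 i = 1].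
pose F (lam : 'rV[R]_(size V)) := \sum_(i < size V) lam ord0 i *: V`_i.
have cS : compact S.
  have := @rV_compact R (size V) (fun _ => `[0, 1]%classic) (fun _ => @segment_compact R 0 1).
  move=> cB; apply: (subclosed_compact _ cB); last by move=> lam [].
  have -> : S = [set lam : 'rV[R]_(size V) | forall i, `[0, 1]%classic (lam ord0 i)] `&`
     (fun lam : 'rV[R]_(size V) => \sum_(i < size V) lam ord0 i) @^-1` [set 1].
    by apply/seteqP; split => lam [].
  apply: closedI; first exact: compact_closed.
  apply: closed_comp; last by apply: compact_closed => //; exact: compact_set1.
  move=> lam _; move: lam; apply: (continuous_big (op := +%R)) => [|i _]; first exact: add_continuous.
  exact: coord_continuous.
have -> : conv_hull V = F @` S.
  apply/seteqP; split => [x [lam [l0 l1 ->]] | _ [lam [l0 l1] <-]].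
    exists (\row_i lam i); last by rewrite /F; apply: eq_bigr => i _; rewrite mxE.
    split => [i|]; last by rewrite -l1; apply: eq_bigr => i _; rewrite mxE.
    rewrite mxE/= in_itv/= l0/= -l1 (bigD1 i)//= lerDl.
    by apply: sumr_ge0.
  exists (fun i => lam ord0 i); split => // i.
  by have := l0 i; rewrite /= in_itv/= => /andP[].
apply: continuous_compact => //; apply: continuous_subspaceT.
apply: (@continuous_big 'rV[R]_n _ +%R 0 xpredT) => [|i _]; first exact: add_continuous.
move=> lam.
apply: (@continuous_comp _ _ _ (fun lam : 'rV[R]_(size V) => lam ord0 i) (fun k : R => k *: V`_i)).
  exact: coord_continuous.
exact: scalel_continuous.
Qed.

Lemma conv_hull_segment n (V : seq 'rV[R]_n) x y t :
  conv_hull V x -> conv_hull V y -> 0 <= t <= 1 -> conv_hull V ((1 - t) *: x + t *: y).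
Proof.
move=> [a [a0 a1 ->]] [b [b0 b1 ->]] /andP[t0 t1].
exists (fun i => (1 - t) * a i + t * b i); split.
- by move=> i; rewrite addr_ge0// mulr_ge0// subr_ge0.
- by rewrite big_split/= -!mulr_sumr a1 b1; ring.
- rewrite !scaler_sumr -big_split/=; apply: eq_bigr => i _.
  by rewrite !scalerA -scalerDl.
Qed.

End Compact.

(** * Blow-up at a point of a convex set *)

Section TangentCone.
Variable R : realType.
Variable n : nat.
Implicit Types (P C : set 'rV[R]_n) (x z : 'rV[R]_n).

Definition convex_set_rV P := forall x y t, P x -> P y -> 0 <= t <= 1 ->
  P ((1 - t) *: x + t *: y).

(** One positive step suffices, since convexity supplies all shorter ones. No closure is taken, so
    the blow-up limit holds at every z and no null set has to be discarded. *)
Definition tcone P x := [set z | exists2 t, 0 < t & P (x + t *: z)].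

(** The point x + s z is the barycentre of x and x + t z with weight s / t on the latter. *)
Lemma tcone_shrink P x z s t : convex_set_rV P -> P x -> 0 < s -> s <= t ->
  P (x + t *: z) -> P (x + s *: z).
Proof.
move=> cP Px s0 st Pt; have t0 : 0 < t by exact: lt_le_trans st.
have st1 : 0 <= s / t <= 1.
  by apply/andP; split; [exact: divr_ge0 (ltW s0) (ltW t0)|rewrite ler_pdivrMr// mul1r].
have := cP _ _ (s / t) Px Pt st1.
rewrite scalerDr addrA -scalerDl subrK scale1r scalerA divfK//.
by rewrite gt_eqF.
Qed.

(** By [tcone_shrink] the steps 1/(k+1) suffice, which turns the cone into a countable union of
    affine preimages of P. *)
Lemma measurable_tcone P x : convex_set_rV P -> P x ->
  measurable (P : set (rvec R n)) -> measurable (tcone P x : set (rvec R n)).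
Proof.
move=> cP Px mP.
rewrite (_ : tcone P x = \bigcup_k ((fun z : rvec R n => (x + k.+1%:R^-1 *: (z : 'rV[R]_n) : rvec R n)) @^-1` P)).
  apply: bigcupT_measurable => k; rewrite -[X in measurable X]setTI.
  exact: measurable_affine.
apply/seteqP; split => [z [t t0 Pt] | z [k _ Pk]]; last first.
  by exists k.+1%:R^-1; rewrite ?invr_gt0.
have [k _ /(_ k (leqnn k)) /= kt] := near_infty_natSinv_lt (PosNum t0).
by exists k => //=; apply: (tcone_shrink cP Px _ (ltW kt) Pt); rewrite invr_gt0.
Qed.

Lemma tcone_scale P x z s : 0 < s -> tcone P x z -> tcone P x (s *: z).
Proof.
move=> s0 [t t0 Pt]; exists (t / s); first exact: divr_gt0.
by rewrite scalerA divfK// gt_eqF.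
Qed.

Section BlowUp.
Variables (P : set 'rV[R]_n) (f : 'rV[R]_n -> R) (x : 'rV[R]_n) (u : R^nat).
Hypotheses (cK : compact P) (cP : convex_set_rV P).
Hypotheses (fc : {within P, continuous f}) (f0 : forall y, ~ P y -> f y = 0).
Hypotheses (u0 : forall k, 0 < u k) (uc : u @ \oo --> (0 : R)).

Lemma blow_up_path z : x + u k *: z @[k --> \oo] --> x.
Proof.
rewrite -[X in _ --> X]addr0; apply: cvgD; first exact: cvg_cst.
rewrite -[X in _ --> X](scale0r z); apply: cvgZr_tmp; exact: uc.
Qed.

(** Off P, closedness keeps the path outside P eventually. On P, the path either never meets P (z
    outside the cone) or stays in P once [u k] is below a feasible step, and then continuity within
    P applies. *)
Lemma blow_up_cvg z : f (x + u k *: z) @[k --> \oo] --> f x * \1_(tcone P x) z.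
Proof.
have [Px|Px] := pselect (P x); last first.
  rewrite f0// mul0r.
  have clP : closed P by apply: compact_closed.
  have nPx : \forall y \near x, ~ P y.
    by apply: open_nbhs_nbhs; split => //; exact: closed_openC.
  apply: cvg_near_cst; have [k0 _ h] := blow_up_path z nPx.
  by exists k0 => // k /h /=; exact: f0.
rewrite indicE; have [zC|zC] := boolP (z \in tcone P x); last first.
  rewrite mulr0; apply: cvg_near_cst; apply: nearW => k; apply: f0 => Pk.
  by move/negP : zC; apply; rewrite inE; exists (u k).
rewrite mulr1; move: zC; rewrite inE => -[t t0 Pt].
apply: (cvg_comp _ _ _ (within_continuous_cvg fc Px)) => A.
rewrite /within/= => nA.
have := blow_up_path z nA.
have /cvgrPdist_lt/(_ t t0) := uc.
apply: filterS2 => k; rewrite sub0r normrN gtr0_norm// => ut; apply.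
exact: tcone_shrink (ltW ut) Pt.
Qed.

(** The weight g is the Gaussian for the convolution and the indicator of the unit ball for [omega].
    Sequences are used because dominated convergence is sequential; the dominating function is a
    bound of |f| times g. *)
Lemma blow_up_integral_cvg (g : rvec R n -> R) :
  measurable_fun setT g -> (forall z, 0 <= g z) ->
  (leb R n).-integrable setT (fun z => (g z)%:E) ->
  fine (\int[leb R n]_z (f (x + u k *: (z : 'rV[R]_n)) * g z)%:E)%E @[k --> \oo] -->
  f x * fine (\int[leb R n]_z (\1_(tcone P x) (z : 'rV[R]_n) * g z)%:E)%E.
Proof.
move=> mg g0 ig.
have mf : measurable_fun setT (f : rvec R n -> R) by exact: measurable_extension cK fc f0.
have [C [M [C0 M0 fCM]]] := box_bounded_extension cK fc f0.
have fC y : `|f y| <= C.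
  by rewrite (le_trans (fCM y))// ler_piMr// box_fun_le1.
have mfk k : measurable_fun setT (fun z : rvec R n => f (x + u k *: (z : 'rV[R]_n))).
  exact: (measurableT_comp mf (measurable_affine x (u k))).
have mlim : measurable_fun setT (fun z : rvec R n => f x * \1_(tcone P x) (z : 'rV[R]_n) * g z).
  (* Measurability of the cone is available at points of P only; elsewhere [f x = 0] kills the
     product. *)
  have [Px|Px] := pselect (P x); last first.
    rewrite f0//; under eq_fun do rewrite mul0r mul0r.
    exact: measurable_cst.
  apply: measurable_funM => //; apply: measurable_funM => //.
  by apply: measurable_indic; apply: measurable_tcone => //; exact: compact_measurable.
have := @dominated_cvg _ _ _ (leb R n) setT measurableT
  (fun k z => (f (x + u k *: (z : 'rV[R]_n)) * g z)%:E)
  (fun z => (f x * \1_(tcone P x) (z : 'rV[R]_n) * g z)%:E)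
  (fun z => (C * g z)%:E).
have iC : (leb R n).-integrable setT (fun z => (C * g z)%:E).
  by under eq_fun do rewrite EFinM; exact: integrableZl.
have -> : f x * fine (\int[leb R n]_z (\1_(tcone P x) (z : 'rV[R]_n) * g z)%:E)%E =
  fine (\int[leb R n]_z (f x * \1_(tcone P x) (z : 'rV[R]_n) * g z)%:E)%E.
  have [Px|Px] := pselect (P x); last first.
    rewrite f0// mul0r.
    under eq_integral do rewrite mul0r mul0r.
    by rewrite integral0.
  under [in RHS]eq_integral do rewrite -mulrA EFinM.
  have mT : measurable (tcone P x : set (rvec R n)).
    by apply: measurable_tcone => //; exact: compact_measurable.
  have iT : (leb R n).-integrable setT (fun z : rvec R n => (\1_(tcone P x) (z : 'rV[R]_n) * g z)%:E).
    apply: le_integrable ig => //.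
      by apply/measurable_EFinP; apply: measurable_funM => //; exact: measurable_indic.
    move=> z _; rewrite /= lee_fin normrM ler_piMl// indicE ger0_norm ?ler0n//.
    by rewrite lern1; case: (_ \in _).
  rewrite integralZl// fineM//; exact: integrable_fin_num.
move=> H; apply: fine_cvg.
rewrite fineK; last first.
  apply: integrable_fin_num => //; apply: le_integrable iC => //.
    exact/measurable_EFinP.
  move=> z _; rewrite /= lee_fin !normrM (ger0_norm C0) (ger0_norm (g0 z)) ler_wpM2r//.
  apply: (le_trans _ (fC x)); rewrite ler_piMr// indicE ger0_norm ?ler0n//.
  by rewrite lern1; case: (_ \in _).
apply: H => //.
- by move=> k; apply/measurable_EFinP; exact: measurable_funM.
- move=> z _; apply: cvg_EFin; first exact: nearW.
  by apply: cvgM; [exact: blow_up_cvg|exact: cvg_cst].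
- by move=> k z _; rewrite lee_fin normrM (ger0_norm (g0 z)) ler_wpM2r.
Qed.

End BlowUp.
End TangentCone.

(** * Gaussian mass of a cone *)

Section Gaussian.
Variable R : realType.
Notation lebR := (@lebesgue_measure R).

Lemma sqnorm_ge0 n (z : 'rV[R]_n) : 0 <= sqnorm z.
Proof. by apply: sumr_ge0 => i _; exact: sqr_ge0. Qed.

Lemma sqnormZ n (s : R) (z : 'rV[R]_n) : sqnorm (s *: z) = s ^+ 2 * sqnorm z.
Proof. by rewrite /sqnorm mulr_sumr; apply: eq_bigr => i _; rewrite mxE exprMn. Qed.

Lemma measurable_sqnorm n : measurable_fun setT (@sqnorm R n : rvec R n -> R).
Proof.
apply: measurable_sum => i; apply: measurable_funX; exact: measurable_coord.
Qed.

Lemma measurable_eball n (x : 'rV[R]_n) r : measurable (eball x r : set (rvec R n)).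
Proof.
rewrite (_ : eball x r = (fun y : rvec R n => sqnorm (- x + 1 *: (y : 'rV[R]_n))) @^-1` `]-oo, r ^+ 2[).
  rewrite -[X in measurable X]setTI.
  exact: (measurableT_comp (@measurable_sqnorm n) (measurable_affine (- x) 1)).
by apply/seteqP; split => y; rewrite /eball/= in_itv/= scale1r addrC.
Qed.

(** The variance eps / (2 pi) turns the normal density into the one-dimensional factor of
    [gauss eps]: its peak is 1/sqrt(eps) and its exponent -pi (t - m)^2 / eps. Total mass 1 is then
    inherited from [normal_pdf]. *)
Definition gauss_sd (eps : R) : R := Num.sqrt (eps / (pi *+ 2)).

Lemma gauss_sd_sqr eps : 0 < eps -> gauss_sd eps ^+ 2 = eps / (pi *+ 2).
Proof.
by move=> e0; rewrite sqr_sqrtr// divr_ge0 ?ltW// mulrn_wgt0// pi_gt0.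
Qed.

Lemma gauss_sd_neq0 eps : 0 < eps -> gauss_sd eps != 0.
Proof.
by move=> e0; rewrite gt_eqF// sqrtr_gt0 divr_gt0// mulrn_wgt0// pi_gt0.
Qed.

Lemma gauss_pdf1E eps (m t : R) : 0 < eps ->
  normal_pdf m (gauss_sd eps) t = (Num.sqrt eps)^-1 * expR (- (pi * (m - t) ^+ 2) / eps).
Proof.
move=> e0; rewrite normal_pdfE ?gauss_sd_neq0// /normal_peak /normal_fun gauss_sd_sqr//.
have p0 : (pi : R) != 0 by rewrite gt_eqF// pi_gt0.
have ep0 : eps != 0 by rewrite gt_eqF.
move: (pi : R) p0 => p p0; congr (_ * _); last by congr expR; field; rewrite p0 ep0.
by rewrite (_ : eps / (p *+ 2) * p *+ 2 = eps)//; field; rewrite p0.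
Qed.

Lemma gauss_pdfE n eps (x y : 'rV[R]_n) : 0 < eps ->
  gauss eps (x - y) = \prod_(i < n) normal_pdf (x ord0 i) (gauss_sd eps) (y ord0 i).
Proof.
move=> e0; under eq_bigr do rewrite gauss_pdf1E//.
rewrite big_split/= prodr_const card_ord -expR_sum /gauss; congr (_ * expR _).
  rewrite powRN [n%:R / 2]mulrC powRrM powR12_sqrt ?ltW// powR_mulrn ?sqrtr_ge0//.
  by rewrite exprVn.
rewrite /sqnorm mulr_sumr -sumrN mulr_suml; apply: eq_bigr => i _.
by rewrite !mxE.
Qed.

Lemma gauss_ge0 n eps (x : 'rV[R]_n) : 0 <= gauss eps x.
Proof. by rewrite mulr_ge0 ?powR_ge0 ?expR_ge0. Qed.

Lemma measurable_gauss n eps : measurable_fun setT (@gauss R n eps : rvec R n -> R).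
Proof.
apply: measurable_funM => //; apply: measurableT_comp => //.
apply: measurable_funM => //; apply: measurableT_comp => //.
apply: measurable_funM => //; exact: measurable_sqnorm.
Qed.

Lemma gauss_oppr n eps (x : 'rV[R]_n) : gauss eps (- x) = gauss eps x.
Proof. rewrite /gauss (_ : sqnorm (- x) = sqnorm x)//.
by rewrite -scaleN1r sqnormZ sqrrN expr1n mul1r. Qed.

Lemma gauss1 n (x : 'rV[R]_n) : gauss 1 x = expR (- (pi * sqnorm x)).
Proof. by rewrite /gauss powR1 mul1r divr1. Qed.

Lemma gauss_scale n eps (x : 'rV[R]_n) : 0 < eps ->
  gauss eps (Num.sqrt eps *: x) = Num.sqrt eps ^- n * gauss 1 x.
Proof.
move=> e0; rewrite gauss1 /gauss sqnormZ sqr_sqrtr ?ltW//; congr (_ * expR _).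
  rewrite powRN [n%:R / 2]mulrC powRrM powR12_sqrt ?ltW// powR_mulrn ?sqrtr_ge0//.
by field; rewrite gt_eqF.
Qed.

Lemma integral_gauss n eps (x : 'rV[R]_n) : 0 < eps ->
  (\int[leb R n]_y (gauss eps (x - (y : 'rV[R]_n)))%:E = 1)%E.
Proof.
move=> e0; under eq_integral do rewrite gauss_pdfE//.
rewrite (@ge0_integral_prod R n (fun i => normal_pdf (x ord0 i) (gauss_sd eps))).
- by apply: big1 => i _; exact: integral_normal_pdf.
- by move=> i; exact: measurable_normal_pdf.
- by move=> i t; exact: normal_pdf_ge0.
Qed.

Lemma integral_gauss1 n : (\int[leb R n]_y (gauss 1 (y : 'rV[R]_n))%:E = 1)%E.
Proof.
transitivity (\int[leb R n]_y (gauss 1 (0 - (y : 'rV[R]_n)))%:E)%E; last exact: integral_gauss.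
by apply: eq_integral => y _; rewrite sub0r gauss_oppr.
Qed.

Lemma integrable_gauss1 n : (leb R n).-integrable setT (fun y => (gauss 1 (y : 'rV[R]_n))%:E).
Proof.
apply/integrableP; split; first by apply/measurable_EFinP; exact: measurable_gauss.
under eq_integral do rewrite gee0_abs ?lee_fin ?gauss_ge0//.
by rewrite integral_gauss1 ltry.
Qed.

End Gaussian.

(** * Cones: volume in balls against Gaussian mass *)

Section Cone.
Variable R : realType.
Variable n : nat.
Implicit Types C : set 'rV[R]_n.

(** The parameter is the squared radius, so that these sets are the preimages of the rays ]-oo, r[
    under [sqnorm]. *)
Definition ball0 (r : R) : set 'rV[R]_n := [set z | sqnorm z < r].

Lemma measurable_ball0 r : measurable (ball0 r : set (rvec R n)).
Proof.
rewrite (_ : ball0 r = (@sqnorm R n : rvec R n -> measurableTypeR R) @^-1` `]-oo, r[).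
  by rewrite -[X in measurable X]setTI; exact: measurable_sqnorm.
by apply/seteqP; split => z; rewrite /ball0/= in_itv.
Qed.

Definition cone C := forall s z, 0 < s -> C z -> C (s *: z).

(** Dilation by sqrt r carries the unit part of C onto its part in [ball0 r]. The factor does not
    depend on C, which makes the ratio to the full ball constant in r. *)
Lemma leb_cone_ball C (r : R) : cone C -> measurable (C : set (rvec R n)) -> 0 < r ->
  leb R n (C `&` ball0 r) = ((Num.sqrt r ^+ n)%:E * leb R n (C `&` ball0 1))%E.
Proof.
move=> cC mC r0; have s0 : 0 < Num.sqrt r by rewrite sqrtr_gt0.
have mCr t : measurable (C `&` ball0 t : set (rvec R n)).
  by apply: measurableI => //; exact: measurable_ball0.
have := @ge0_leb_affine R n 0 (Num.sqrt r) (fun z => (\1_(C `&` ball0 r : set (rvec R n)) z)%:E) s0.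
have -> : (fun z : rvec R n => (\1_(C `&` ball0 r : set (rvec R n)) (0 + Num.sqrt r *: (z : 'rV[R]_n)) : R)%:E) =
    (fun z => (\1_(C `&` ball0 1 : set (rvec R n)) z : R)%:E).
  apply/funext => z; rewrite add0r !indicE; congr (((nat_of_bool _)%:R : R)%:E).
  apply/idP/idP; rewrite !inE /ball0 /= sqnormZ sqr_sqrtr ?ltW// => -[Cz zr]; split.
  - rewrite -[z](scalerK (lt0r_neq0 s0)); apply: cC => //.
    by rewrite invr_gt0.
  - by move: zr; rewrite gtr_pMr.
  - exact: cC.
  - by rewrite gtr_pMr.
rewrite !integral_indic// !setIT => ->//; last first.
  by apply/measurable_EFinP; exact: measurable_indic.
by rewrite muleA -EFinM divff ?mul1e// expf_neq0// gt_eqF.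
Qed.

Lemma leb_ball0_lty : (leb R n (ball0 1) < +oo)%E.
Proof.
have := integral_box_fun n (@ler01 R).
move=> H; rewrite (leb_indic (@measurable_ball0 1)).
apply: (@le_lt_trans _ _ (\int[leb R n]_x (box_fun 1 x)%:E)%E); last by rewrite H ltry.
apply: ge0_le_integral => //.
- by apply/measurable_EFinP; apply: measurable_indic; exact: measurable_ball0.
- by apply/measurable_EFinP; exact: measurable_box_fun.
move=> x _; rewrite lee_fin indicE; case: (boolP (x \in _)); last by rewrite box_fun_ge0.
rewrite inE /ball0/= => x1; rewrite box_funE// => i.
rewrite -(@ler_pXn2r _ 2)// ?nnegrE// expr1n -normrX ger0_norm ?sqr_ge0//.
apply: le_trans (ltW x1); rewrite /sqnorm (bigD1 i)//= lerDl.
by apply: sumr_ge0 => j _; exact: sqr_ge0.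
Qed.

Lemma leb_ball0_gt0 : (0 < leb R n (ball0 1))%E.
Proof.
(* The cube of half-side a = 1/(n+1) lies in the unit ball because n a^2 = a (1 - a) < 1, including
   n = 0. *)
pose a : R := n.+1%:R^-1; have a0 : 0 < a by rewrite invr_gt0.
apply: (@lt_le_trans _ _ (\int[leb R n]_x (box_fun a x)%:E)%E).
  by rewrite integral_box_fun ?ltW// lte_fin exprn_gt0// mulrn_wgt0.
rewrite (leb_indic (@measurable_ball0 1)).
apply: ge0_le_integral => //.
- by move=> x _; rewrite lee_fin box_fun_ge0.
- by apply/measurable_EFinP; exact: measurable_box_fun.
- by apply/measurable_EFinP; apply: measurable_indic; exact: measurable_ball0.
move=> x _; rewrite lee_fin indicE; case: (boolP (x \in _)); first by rewrite box_fun_le1.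
move/negP => xB; rewrite le_eqVlt; apply/orP; left; apply/eqP.
have [i xi] : exists i, ~ `|(x : 'rV[R]_n) ord0 i| <= a.
  apply: contrapT => h; apply: xB; rewrite inE /ball0/=.
  have {}h i : `|(x : 'rV[R]_n) ord0 i| <= a by apply: contrapT => xi; apply: h; exists i.
  apply: (@le_lt_trans _ _ (\sum_(i < n) a ^+ 2)).
    apply: ler_sum => i _; rewrite -[leLHS]ger0_norm ?sqr_ge0// normrX.
    by rewrite ler_pXn2r// nnegrE ltW.
  rewrite sumr_const card_ord -mulr_natr.
  have aN : a * n%:R = 1 - a.
    by apply/eqP; rewrite eq_sym subr_eq -{2}[a]mulr1 -mulrDr natr1 mulVf.
  rewrite expr2 -mulrA aN; have : 0 <= a * n%:R by rewrite mulr_ge0// ltW.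
  by rewrite aN => ?; nra.
rewrite /box_fun (bigD1 i)//= indicE memNset ?mul0r//=.
by rewrite in_itv/= -ler_norml.
Qed.

(* |z|^2 on C and -1 off C, so that the push-forward restricted to [0, +oo[
   is the law of |z|^2 on C. *)
Definition radial C (z : rvec R n) : measurableTypeR R :=
  (sqnorm (z : 'rV[R]_n) + 1) * \1_(C : set (rvec R n)) z - 1.

Lemma measurable_radial C : measurable (C : set (rvec R n)) ->
  measurable_fun setT (radial C).
Proof.
move=> mC; apply: measurable_funB => //; apply: measurable_funM.
  by apply: measurable_funD => //; exact: measurable_sqnorm.
exact: measurable_indic.
Qed.

Lemma radial_ge0 C z : (0 <= radial C z) = (z \in C).
Proof.
rewrite /radial indicE; case: (z \in C).
  by rewrite mulr1 addrK sqnorm_ge0.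
by rewrite mulr0 sub0r; apply/negbTE; rewrite -ltNge oppr_lt0.
Qed.

Lemma radialE C z : C z -> radial C z = sqnorm z.
Proof. by move=> Cz; rewrite /radial indicE mem_set// mulr1 addrK. Qed.

(* The laws of |z|^2 on C and on the whole space give ]-oo, r[ masses in the
   ratio leb(C `&` ball) : leb(ball) for every r, hence are proportional. *)
Lemma cone_gauss C : cone C -> measurable (C : set (rvec R n)) ->
  (leb R n (ball0 1) * \int[leb R n]_z (\1_(C : set (rvec R n)) z * gauss 1 (z : 'rV[R]_n))%:E
   = leb R n (C `&` ball0 1))%E.
Proof.
move=> cC mC.
have mB : measurable (C `&` ball0 1 : set (rvec R n)).
  by apply: measurableI => //; exact: measurable_ball0.
have C1oo : (leb R n (C `&` ball0 1) < +oo)%E.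
  apply: (le_lt_trans _ leb_ball0_lty); apply: le_measure; rewrite ?inE//.
  exact: measurable_ball0.
have fC : leb R n (C `&` ball0 1) \is a fin_num by rewrite ge0_fin_numE.
have fB : leb R n (ball0 1) \is a fin_num by rewrite ge0_fin_numE// leb_ball0_lty.
pose nu (A : set 'rV[R]_n) (mA : measurable (A : set (rvec R n))) :=
  measure_function_pushforward__canonical__measure_function_Measure (leb R n) (measurable_radial mA).
pose D : set (measurableTypeR R) := `[0, +oo[%classic.
have mD : measurable D by exact: measurable_itv.
pose b := NngNum (fine_ge0 (measure_ge0 (leb R n) (ball0 1))).
pose c := NngNum (fine_ge0 (measure_ge0 (leb R n) (C `&` ball0 1))).
have nuE (A : set 'rV[R]_n) (mA : measurable (A : set (rvec R n))) r :
    nu A mA (`]-oo, r[ `&` D) = leb R n (A `&` ball0 r).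
  rewrite /nu/= /pushforward; congr (leb R n _); apply/seteqP; split => z /=.
    by rewrite /D/= !in_itv/= andbT radial_ge0 inE => -[+ Az]; rewrite radialE.
  by move=> [Az zr]; rewrite /D/= !in_itv/= andbT radial_ge0 inE radialE.
have coneT : cone setT by [].
(* Proportionality is written cross-multiplied, and restriction to [D] removes the mass that
   [radial] puts at -1. The rays ]-oo, r[ are stable under intersection, and those with r = k
   exhaust the line with finite mass. *)
have key (A : set (measurableTypeR R)) : measurable A ->
    mscale b (mrestr (nu C mC) mD) A = mscale c (mrestr (nu setT measurableT) mD) A.
  apply: (@measure_unique _ R (measurableTypeR R) (@RGenInftyO.G R)
    (fun k : nat => `]-oo, k%:R[%classic) (RGenInftyO.measurableE R) _ _ _
    (mscale b (mrestr (nu C mC) mD)) (mscale c (mrestr (nu setT measurableT) mD))).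
  - move=> _ _ [x ->] [y ->]; exists (Num.min x y).
    by apply/seteqP; split => z /=; rewrite !in_itv/= lt_min => /andP.
  - by move=> k; exists k%:R.
  - rewrite -subTset => x _; exists (Num.truncn `|x|).+1 => //=.
    by rewrite in_itv/= (le_lt_trans (ler_norm x))// truncnS_gt.
  - move=> _ [r ->]; transitivity (b%:num%:E * leb R n (C `&` ball0 r))%E.
      by rewrite -(nuE C mC).
    transitivity (c%:num%:E * leb R n (setT `&` ball0 r))%E; last first.
      by rewrite -(nuE setT measurableT).
    have [r0|r0] := leP r 0.
      have -> : ball0 r = set0.
        apply/seteqP; split => // z; rewrite /ball0/= => /lt_le_trans/(_ r0).
        by rewrite ltNge sqnorm_ge0.
      by rewrite !setI0 !measure0 !mule0.
    rewrite (leb_cone_ball cC mC r0) (leb_cone_ball coneT measurableT r0) setTI !fineK//.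
    by rewrite muleCA [RHS]muleCA; congr (_ * _)%E; rewrite muleC.
  - move=> k; apply: (@le_lt_trans _ _ (b%:num%:E * leb R n (C `&` ball0 k%:R))%E).
      by rewrite -(nuE C mC).
    rewrite lte_mul_pinfty//.
    (* For k = 0 [leb_cone_ball] does not apply; enlarging to k + 1 keeps the squared radius
       positive. *)
    apply: (@le_lt_trans _ _ (leb R n (C `&` ball0 k.+1%:R))).
      apply: le_measure; rewrite ?inE//; do ?by apply: measurableI => //; exact: measurable_ball0.
      by move=> z [Cz zk]; split => //; apply: lt_le_trans zk _; rewrite ler_nat.
    by rewrite (leb_cone_ball cC mC)// lte_mul_pinfty// lee_fin exprn_ge0// sqrtr_ge0.
(* The Gaussian depends on z only through |z|^2, so its integral over A is that of exp(-pi s)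
   against the law [nu A] on [D]. *)
have gE (A : set 'rV[R]_n) (mA : measurable (A : set (rvec R n))) :
   (\int[leb R n]_z (\1_(A : set (rvec R n)) z * gauss 1 (z : 'rV[R]_n))%:E =
    \int[nu A mA]_(s in D) (expR (- (pi * s)))%:E)%E.
  have mexp : measurable_fun setT (fun s : measurableTypeR R => (expR (- (pi * s)))%:E).
    apply/measurable_EFinP; apply: measurableT_comp => //.
    by apply: measurableT_comp => //; exact: measurable_funM.
  rewrite (ge0_integral_pushforward (measurable_radial mA))//; last exact: measurable_funTS.
  rewrite [RHS]integral_mkcond; apply: eq_integral => z _.
  rewrite patchE indicE; have [zA|zA] := boolP (z \in A).
    rewrite mem_set ?mul1r; last by rewrite /D/= in_itv/= andbT radial_ge0.
    by move: zA; rewrite inE => zA; rewrite /= radialE// gauss1.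
  rewrite memNset ?mul0r// /D/= in_itv/= andbT radial_ge0.
  exact/negP.
have mexpD : measurable_fun D (fun s : measurableTypeR R => (expR (- (pi * s)))%:E).
  apply: measurable_funTS; apply/measurable_EFinP; apply: measurableT_comp => //.
  by apply: measurableT_comp => //; exact: measurable_funM.
have := gE setT measurableT.
under eq_integral do rewrite indicT mul1r.
rewrite integral_gauss1 => gT.
rewrite gE -(fineK fB).
transitivity (\int[mscale b (nu C mC)]_(s in D) (expR (- (pi * s)))%:E)%E.
  by rewrite ge0_integral_mscale.
rewrite (eq_measure_integral (mscale c (nu setT measurableT))).
  rewrite ge0_integral_mscale//=.
  by rewrite -gT mule1 fineK.
move=> A mA AD; have := key A mA.
have AE : A `&` D = A by apply/seteqP; split => [x []|x Ax]//; split => //; exact: AD.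
by rewrite /mscale/= /mrestr AE.
Qed.

End Cone.

(** * Solid angles and the pointwise limit of the convolution *)

Section Pointwise.
Variable R : realType.
Variable n : nat.
Notation lebR := (@lebesgue_measure R).

(** The nonnegative case is applied to the positive and negative parts; integrability makes both
    integrals finite, so the factor distributes over their difference. *)
Lemma leb_affine (a : 'rV[R]_n) (s : R) (h : rvec R n -> \bar R) : 0 < s ->
  (leb R n).-integrable setT h ->
  (\int[leb R n]_z h (a + s *: (z : 'rV[R]_n))%R = (s ^- n)%:E * \int[leb R n]_z h z)%E.
Proof.
move=> s0 ih; have [mh _] := integrableP _ _ _ ih.
rewrite integralE [in RHS]integralE.
have -> : (\int[leb R n]_z (fun z => h (a + s *: (z : 'rV[R]_n))%R)^\+ z =
   (s ^- n)%:E * \int[leb R n]_z h^\+ z)%E.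
  have m1 : measurable_fun setT (h^\+)%E by exact: measurable_funepos.
  rewrite -(ge0_leb_affine a s0 m1); last by move=> t; exact: funepos_ge0.
  by apply: eq_integral => z _; rewrite funepos.unlock.
have -> : (\int[leb R n]_z (fun z => h (a + s *: (z : 'rV[R]_n))%R)^\- z =
   (s ^- n)%:E * \int[leb R n]_z h^\- z)%E.
  have m1 : measurable_fun setT (h^\-)%E by exact: measurable_funeneg.
  rewrite -(ge0_leb_affine a s0 m1); last by move=> t; exact: funeneg_ge0.
  by apply: eq_integral => z _; rewrite funeneg.unlock.
have f1 : (\int[leb R n]_z h^\+ z)%E \is a fin_num.
  by apply: integrable_fin_num => //; exact: integrable_funepos.
have f2 : (\int[leb R n]_z h^\- z)%E \is a fin_num.
  by apply: integrable_fin_num => //; exact: integrable_funeneg.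
transitivity ((s ^- n)%:E * (\int[leb R n]_z h^\+ z - \int[leb R n]_z h^\- z))%E => //.
move: f1 f2; move: (\int[leb R n]_z h^\+ z)%E (\int[leb R n]_z h^\- z)%E.
move=> [p||] [q||]// _ _.
exact: (congr1 EFin (esym (mulrBr (s ^- n) p q))).
Qed.

Section Body.
Variable P : set 'rV[R]_n.
Hypotheses (cK : compact P) (cP : convex_set_rV P).

Let mP : measurable (P : set (rvec R n)) := compact_measurable cK.

Definition solid_angle x :=
  fine (leb R n (tcone P x `&` ball0 1)) / fine (leb R n (ball0 1)).

(** Under y = x + r z the Jacobian r^n cancels between numerator and denominator; the numerator is
    then a blow-up integral of the indicator of P. *)
Lemma omegaE x : P x -> omega P x = solid_angle x.
Proof.
move=> Px; apply/cvg_lim => //; apply/cvg_at_rightP => u [u0 uc].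
have mB : measurable (ball0 1 : set (rvec R n)) by exact: measurable_ball0.
have ratio k : fine (vol (eball x (u k) `&` P)) / fine (vol (eball x (u k))) =
   fine (\int[leb R n]_z (\1_P (x + u k *: (z : 'rV[R]_n)) * \1_(ball0 1 : set (rvec R n)) z)%:E)%E /
   fine (leb R n (ball0 1)).
  have r0 := u0 k.
  have volS (A : set 'rV[R]_n) (mA : measurable (A : set (rvec R n))) :
      vol A = ((u k ^+ n)%:E * \int[leb R n]_z (\1_(A : set (rvec R n)) (x + u k *: (z : 'rV[R]_n)))%:E)%E.
    rewrite volE// (@ge0_leb_affine R n x (u k) (fun z => (\1_(A : set (rvec R n)) z)%:E))//; last first.
      by apply/measurable_EFinP; exact: measurable_indic.
    by rewrite integral_indic// setIT muleA -EFinM divff ?mul1e// expf_neq0// gt_eqF.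
  have inball z : (x + u k *: z \in eball x (u k)) = (z \in ball0 1).
    apply/idP/idP; rewrite !inE /eball /ball0/= addrAC subrr add0r sqnormZ gtr_pMr// exprn_gt0//.
  rewrite !volS; [|exact: measurable_eball|by apply: measurableI => //; exact: measurable_eball].
  have e1 : (\int[leb R n]_z (\1_(eball x (u k) : set (rvec R n)) (x + u k *: (z : 'rV[R]_n)))%:E
      = leb R n (ball0 1))%E.
    rewrite [RHS]leb_indic//; apply: eq_integral => z _.
    by rewrite !indicE inball.
  rewrite e1.
  under eq_integral => z _.
    rewrite indicI/= mulrC (_ : \1_(eball x (u k)) _ = \1_(ball0 1 : set (rvec R n)) z); last first.
      by rewrite !indicE inball.
    over.
  have fB : leb R n (ball0 1) \is a fin_num by rewrite ge0_fin_numE// leb_ball0_lty.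
  have B0 := leb_ball0_gt0 R n.
  rewrite fineM//; last first.
    rewrite ge0_fin_numE; last by apply: integral_ge0 => z _; rewrite lee_fin mulr_ge0.
    apply: (@le_lt_trans _ _ (leb R n (ball0 1))); last exact: leb_ball0_lty.
    rewrite [leRHS]leb_indic//; apply: ge0_le_integral => //.
    - apply/measurable_EFinP; apply: measurable_funM; last exact: measurable_indic.
      have mI : measurable_fun setT (\1_P : rvec R n -> R) by exact: measurable_indic.
      exact: (measurableT_comp mI (measurable_affine x (u k))).
    - by apply/measurable_EFinP; exact: measurable_indic.
    - move=> z _; rewrite lee_fin ler_piMl// indicE lern1; case: (_ \in _) => //.
  rewrite [fine (_ * leb R n _)%E]fineM//= -mulf_div divff ?mul1r// expf_neq0// gt_eqF//.
rewrite (eq_cvg _ _ ratio); apply: cvgM; last exact: cvg_cst.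
(* The indicator of P is itself an admissible f: constant on P, zero outside. *)
have fc : {within P, continuous (\1_P : 'rV[R]_n -> R)}.
  apply: (@subspace_eq_continuous 'rV[R]_n P R (cst 1) (\1_P : 'rV[R]_n -> R)).
    by move=> z; rewrite inE => Pz; rewrite indicE mem_set.
  by apply: continuous_subspaceT; exact: cst_continuous.
have f0 y : ~ P y -> (\1_P y : R) = 0 by move=> Py; rewrite indicE memNset.
have iB : (leb R n).-integrable setT (fun z : rvec R n => (\1_(ball0 1 : set (rvec R n)) z)%:E).
  apply/integrableP; split; first by apply/measurable_EFinP; exact: measurable_indic.
  under eq_integral do rewrite gee0_abs ?lee_fin//.
  by rewrite -leb_indic// leb_ball0_lty.
have mI : measurable_fun setT (\1_(ball0 1 : set (rvec R n)) : rvec R n -> R).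
  exact: measurable_indic.
have := @blow_up_integral_cvg R n P (\1_P : 'rV[R]_n -> R) x u cK cP fc f0 u0 uc
  (\1_(ball0 1 : set (rvec R n)) : rvec R n -> R) mI _ iB.
have B0 z : 0 <= (\1_(ball0 1 : set (rvec R n)) : rvec R n -> R) z by [].
move=> /(_ B0).
rewrite indicE mem_set// mul1r.
have -> : (\int[leb R n]_z (\1_(tcone P x) z * \1_(ball0 1 : set (rvec R n)) z)%:E = leb R n (tcone P x `&` ball0 1))%E.
  rewrite [RHS]leb_indic//; last first.
    by apply: measurableI => //; exact: measurable_tcone.
  by apply: eq_integral => z _; rewrite indicI.
exact.
Qed.

Lemma gauss_tcone x : P x ->
  fine (\int[leb R n]_z (\1_(tcone P x) (z : 'rV[R]_n) * gauss 1 (z : 'rV[R]_n))%:E)%E = solid_angle x.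
Proof.
move=> Px; have mT : measurable (tcone P x : set (rvec R n)) by exact: measurable_tcone.
have cT : cone (tcone P x) by move=> s z s0; exact: tcone_scale.
have := cone_gauss cT mT; rewrite /solid_angle => <-.
have fB : leb R n (ball0 1) \is a fin_num by rewrite ge0_fin_numE// leb_ball0_lty.
have B0 : 0 < fine (leb R n (ball0 1)) by rewrite fine_gt0// leb_ball0_gt0 leb_ball0_lty.
rewrite fineM//; first by rewrite mulrAC divff ?mul1r// gt_eqF.
apply: integrable_fin_num => //; apply: le_integrable (integrable_gauss1 R n) => //.
  apply/measurable_EFinP; apply: measurable_funM; last exact: measurable_gauss.
  exact: measurable_indic.
move=> z _; rewrite /= lee_fin normrM ler_piMl// indicE ger0_norm ?ler0n//.
by rewrite lern1; case: (_ \in _).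
Qed.

Variable f : 'rV[R]_n -> R.
Hypotheses (fc : {within P, continuous f}) (f0 : forall y, ~ P y -> f y = 0).

Definition conv_real (eps : R) (x : 'rV[R]_n) : R :=
  iRint (fun y => f y * gauss eps (x - y)).

Let mf : measurable_fun setT (f : rvec R n -> R) := measurable_extension cK fc f0.

Lemma gauss_le eps (x : 'rV[R]_n) : 0 < eps -> gauss eps x <= eps `^ (- (n%:R / 2)).
Proof.
move=> e0; rewrite ler_piMr ?powR_ge0// -expR0 ler_expR mulNr oppr_le0.
by rewrite divr_ge0 ?mulr_ge0 ?pi_ge0 ?sqnorm_ge0// ltW.
Qed.

Lemma measurable_conv_integrand eps x :
  measurable_fun setT (fun y : rvec R n => f y * gauss eps (x - (y : 'rV[R]_n))).
Proof.
apply: measurable_funM => //.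
have := measurableT_comp (@measurable_gauss R n eps) (measurable_affine (- x) 1).
apply: eq_measurable_fun => y _ /=.
by rewrite scale1r -gauss_oppr opprD opprK.
Qed.

(** The constant contains the peak of the Gaussian and depends on eps; it serves integrability at
    fixed eps only. The uniform estimate is [conv_real_bound]. *)
Lemma box_bounded_conv_integrand eps x : 0 < eps ->
  box_bounded (fun y => f y * gauss eps (x - y)).
Proof.
move=> e0; have [C [M [C0 M0 fCM]]] := box_bounded_extension cK fc f0.
exists (C * eps `^ (- (n%:R / 2))), M; split => //; first by rewrite mulr_ge0// powR_ge0.
move=> y; rewrite normrM mulrAC ler_pM//.
by rewrite ger0_norm ?gauss_ge0// gauss_le.
Qed.

Lemma conv_realE eps x : 0 < eps ->
  conv_real eps x = fine (\int[leb R n]_y (f y * gauss eps (x - (y : 'rV[R]_n)))%:E)%E.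
Proof.
move=> e0; rewrite /conv_real iRintE//; first exact: measurable_conv_integrand.
exact: box_bounded_conv_integrand.
Qed.

(** The Jacobian of z -> x + sqrt(eps) z and the factor of [gauss_scale] are the same power of sqrt
    eps and cancel. *)
Lemma conv_real_scale eps x : 0 < eps ->
  conv_real eps x =
  fine (\int[leb R n]_z (f (x + Num.sqrt eps *: (z : 'rV[R]_n)) * gauss 1 (z : 'rV[R]_n))%:E)%E.
Proof.
move=> e0; rewrite conv_realE//; have s0 : 0 < Num.sqrt eps by rewrite sqrtr_gt0.
have ih := box_bounded_integrable (measurable_conv_integrand eps x) (box_bounded_conv_integrand x e0).
have := leb_affine x s0 ih.
under eq_integral => z _.
  rewrite opprD addrA subrr sub0r gauss_oppr gauss_scale// mulrCA EFinM.
  over.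
move=> H; congr fine; apply/esym.
have sn : (Num.sqrt eps ^- n) != 0 by rewrite invr_eq0 expf_neq0// gt_eqF.
have ig : (leb R n).-integrable setT
   (fun z : rvec R n => (f (x + Num.sqrt eps *: (z : 'rV[R]_n)) * gauss 1 (z : 'rV[R]_n))%:E).
  have [C [M [C0 M0 fCM]]] := box_bounded_extension cK fc f0.
  apply: (@le_integrable _ _ _ _ _ _ _ (fun z : rvec R n => (C * gauss 1 (z : 'rV[R]_n))%:E)) => //.
  - apply/measurable_EFinP; apply: measurable_funM; last exact: measurable_gauss.
    exact: (measurableT_comp mf (measurable_affine x (Num.sqrt eps))).
  - move=> z _; rewrite /= lee_fin !normrM (ger0_norm C0) ler_wpM2r//.
    by apply: (le_trans (fCM _)); rewrite ler_piMr// box_fun_le1.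
  - under eq_fun do rewrite EFinM.
    by apply: integrableZl => //; exact: integrable_gauss1.
move: H; rewrite integralZl// => /(congr1 (fun y => ((Num.sqrt eps ^- n)^-1)%:E * y)%E).
by rewrite !muleA -!EFinM mulVf// !mul1e.
Qed.

Lemma conv_real_cvg x : conv_real eps x @[eps --> 0^'+] --> f x * omega P x.
Proof.
apply/cvg_at_rightP => u [u0 uc].
under eq_cvg do rewrite conv_real_scale//.
have -> : f x * omega P x = f x * fine (\int[leb R n]_z (\1_(tcone P x) (z : 'rV[R]_n) * gauss 1 (z : 'rV[R]_n))%:E)%E.
  have [Px|Px] := pselect (P x); last by rewrite f0// !mul0r.
  by rewrite omegaE// gauss_tcone.
apply: (@blow_up_integral_cvg R n P f x (fun k => Num.sqrt (u k)) cK cP fc f0 _ _ (@gauss R n 1)).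
- by move=> k; rewrite sqrtr_gt0.
- rewrite -(@sqrtr0 R); apply: (cvg_comp _ _ uc); exact: sqrt_continuous.
- exact: measurable_gauss.
- by move=> z; exact: gauss_ge0.
- exact: integrable_gauss1.
Qed.

End Body.
End Pointwise.

(** * Lattice sums over growing boxes *)

Section LatticeSum.
Variable R : realType.

Section Box.
Variable d : nat.

Definition lattice_point (N : nat) (k : {ffun 'I_d -> 'I_(N.*2.+1)}) : 'rV[R]_d :=
  \row_i ((((k i : nat)%:Z - N%:Z)%:~R : R)).

Definition latsum_real (g : 'rV[R]_d -> R) (N : nat) : R :=
  \sum_(k : {ffun 'I_d -> 'I_(N.*2.+1)}) g (lattice_point k).

(** Index k of the larger box stands for the integer k - N', which lies in [-N, N] exactly when N' -
    N <= k <= N' - N + 2N. The truncated subtraction is exact for N <= N'. *)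
Definition inner_box (N N' : nat) (k : {ffun 'I_d -> 'I_(N'.*2.+1)}) : bool :=
  [forall i, (N' - N <= k i)%N && (k i <= N' - N + N.*2)%N].

Lemma latsum_real_inner (g : 'rV[R]_d -> R) (N N' : nat) : (N <= N')%N ->
  latsum_real g N = \sum_(k : {ffun 'I_d -> 'I_(N'.*2.+1)} | inner_box N k) g (lattice_point k).
Proof.
move=> NN'.
pose F (j : {ffun 'I_d -> 'I_(N.*2.+1)}) : {ffun 'I_d -> 'I_(N'.*2.+1)} :=
  [ffun i => inord (j i + (N' - N))].
pose G (k : {ffun 'I_d -> 'I_(N'.*2.+1)}) : {ffun 'I_d -> 'I_(N.*2.+1)} :=
  [ffun i => inord (k i - (N' - N))].
have Fv j i : F j i = (j i + (N' - N))%N :> nat.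
  rewrite ffunE inordK//; have := ltn_ord (j i); rewrite !ltnS => ji.
  by move: (nat_of_ord (j i)) ji => m; rewrite -!addnn => ?; lia.
rewrite (reindex_onto F G) /=; last first.
  move=> k /forallP kin; apply/ffunP => i; apply/val_inj; rewrite /= Fv ffunE.
  have /andP[k1 k2] := kin i.
  by rewrite inordK ?subnK// ltnS leq_subLR.
apply: eq_big => [j|j _].
  apply/esym/andP; split.
    apply/forallP => i; rewrite Fv leq_addl/= addnC leq_add2l.
    by rewrite -ltnS ltn_ord.
  apply/eqP/ffunP => i; apply/val_inj; rewrite ffunE Fv addnK.
  by rewrite inord_val.
congr g; apply/rowP => i; rewrite !mxE Fv; congr (_%:~R).
by rewrite PoszD -subzn//; ring.
Qed.

(** Both differences are sums over the shell between the two boxes and are compared term by term. *)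
Lemma latsum_real_dominated (g h : 'rV[R]_d -> R) (N N' : nat) : (N <= N')%N ->
  (forall x, `|g x| <= h x) ->
  `|latsum_real g N' - latsum_real g N| <= latsum_real h N' - latsum_real h N.
Proof.
move=> NN' gh; rewrite !(latsum_real_inner _ NN').
have split_sum (f : 'rV[R]_d -> R) : latsum_real f N' -
   \sum_(k : {ffun 'I_d -> 'I_(N'.*2.+1)} | inner_box N k) f (lattice_point k) =
   \sum_(k : {ffun 'I_d -> 'I_(N'.*2.+1)} | ~~ inner_box N k) f (lattice_point k).
  by rewrite /latsum_real (bigID (@inner_box N N'))/= addrAC subrr add0r.
rewrite !split_sum; apply: (le_trans (ler_norm_sum _ _ _)).
exact: ler_sum.
Qed.

Lemma latsum_realZ c (g : 'rV[R]_d -> R) N :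
  latsum_real (fun x => c * g x) N = c * latsum_real g N.
Proof. by rewrite /latsum_real mulr_sumr. Qed.

Lemma latsum_real_prod (b : R -> R) N :
  latsum_real (fun x => \prod_(i < d) b (x ord0 i)) N =
  (\sum_(j < N.*2.+1) b (((j : nat)%:Z - N%:Z)%:~R)) ^+ d.
Proof.
rewrite -[d in RHS]card_ord -prodr_const.
rewrite (bigA_distr_bigA (fun (i : 'I_d) (j : 'I_(N.*2.+1)) => b (((j : nat)%:Z - N%:Z)%:~R))).
by apply: eq_bigr => k _; apply: eq_bigr => i _; rewrite mxE.
Qed.

End Box.

(* 1/(|t|+1) - 1/(|t|+2): the sum over the integers telescopes. *)
Definition decay (t : R) : R := ((`|t| + 1) * (`|t| + 2))^-1.

Lemma decay_ge0 t : 0 <= decay t.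
Proof. by rewrite invr_ge0 mulr_ge0// addr_ge0. Qed.

Lemma sum_decay_half N : \sum_(j < N) decay j%:R = 1 - N.+1%:R^-1.
Proof.
elim: N => [|N IH]; first by rewrite big_ord0 invr1 subrr.
rewrite big_ord_recr/= IH /decay ger0_norm//.
rewrite -!natr1; field.
by rewrite !natr1 !pnatr_eq0.
Qed.

Lemma sum_decay N :
  \sum_(j < N.*2.+1) decay (((j : nat)%:Z - N%:Z)%:~R) <= 2.
Proof.
rewrite -(big_mkord xpredT (fun j => decay ((j%:Z - N%:Z)%:~R))).
rewrite (@big_cat_nat _ _ _ N)//=; last by rewrite -addnn -addnS leq_addr.
(* Read backwards, the negative half is decay 1 + ... + decay N: the telescoping sum of N + 1 terms
   without decay 0. *)
have half1 : \sum_(0 <= j < N) decay ((j%:Z - N%:Z)%:~R) <= 1.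
  rewrite big_nat_rev/= add0n big_mkord.
  rewrite (eq_bigr (fun j : 'I_N => decay j.+1%:R)); last first.
    move=> j _; rewrite /decay -subzn// addrAC subrr add0r.
    by rewrite mulrNz normrN.
  have := sum_decay_half N.+1; rewrite big_ord_recl => /(congr1 (fun x => x - decay 0%:R)).
  rewrite addrAC subrr add0r => ->.
  by rewrite -addrA gerDl addrC -opprD oppr_le0 addr_ge0// decay_ge0.
have half2 : \sum_(N <= j < N.*2.+1) decay ((j%:Z - N%:Z)%:~R) <= 1.
  rewrite -{1}[N]add0n big_addn big_mkord.
  rewrite (eq_bigr (fun j : 'I__ => decay j%:R)); last first.
    by move=> j _; rewrite PoszD addrK.
  by rewrite sum_decay_half gerBl.
by rewrite -[leRHS]natr1 addrC; apply: lerD.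
Qed.

Section Limit.
Variable d : nat.

Definition decayd (x : 'rV[R]_d) : R := \prod_(i < d) decay (x ord0 i).

Lemma decayd_ge0 x : 0 <= decayd x.
Proof. by apply: prodr_ge0 => i _; exact: decay_ge0. Qed.

Lemma latsum_decayd_nondecreasing :
  {homo latsum_real decayd : N N' / (N <= N')%N >-> N <= N'}.
Proof.
move=> N N' NN'; rewrite -subr_ge0.
apply: (le_trans _ (@latsum_real_dominated d (fun=> 0) decayd N N' NN' _)) => //.
by move=> x; rewrite normr0 decayd_ge0.
Qed.

Lemma latsum_decayd_cvg : cvgn (latsum_real decayd).
Proof.
apply: nondecreasing_is_cvgn; first exact: latsum_decayd_nondecreasing.
exists (2 ^+ d) => _ [N _ <-]; rewrite latsum_real_prod lerXn2r// ?nnegrE//.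
  by apply: sumr_ge0 => j _; exact: decay_ge0.
exact: sum_decay.
Qed.

Definition decay_tail N := limn (latsum_real decayd) - latsum_real decayd N.

Lemma decay_tail_cvg : decay_tail N @[N --> \oo] --> 0.
Proof.
rewrite -(subrr (limn (latsum_real decayd))).
apply: cvgB; [exact: cvg_cst|exact: latsum_decayd_cvg].
Qed.

Lemma latsum_real_cvg (g : 'rV[R]_d -> R) C :
  (forall x, `|g x| <= C * decayd x) -> cvgn (latsum_real g).
Proof.
(* latsum_real g + C * latsum_real decayd is nondecreasing and bounded. *)
move=> gC.
have dom N N' : (N <= N')%N -> `|latsum_real g N' - latsum_real g N| <=
    C * latsum_real decayd N' - C * latsum_real decayd N.
  by move=> NN'; rewrite -!latsum_realZ; exact: latsum_real_dominated.
have cT : cvgn (fun N => C * latsum_real decayd N).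
  by apply: is_cvgM; [exact: is_cvg_cst|exact: latsum_decayd_cvg].
rewrite (_ : latsum_real g = (fun N => (latsum_real g N + C * latsum_real decayd N) -
    C * latsum_real decayd N)); last by apply/funext => N; rewrite addrK.
apply: is_cvgB => //; apply: nondecreasing_is_cvgn.
  move=> N N' NN'; have := dom _ _ NN'; rewrite ler_norml => /andP[+ _].
  by rewrite lerNl opprB -subr_ge0 => h; rewrite -subr_ge0; apply: le_trans h _; lra.
have [M [_ /(_ (M + 1))]] := cvg_seq_bounded cT.
rewrite ltrDl => /(_ ltr01) TM; exists (2 * (M + 1)) => _ [N _ <-].
have TN : C * latsum_real decayd N <= M + 1.
  by rewrite (le_trans (ler_norm _))//; exact: TM.
have gN : latsum_real g N <= C * latsum_real decayd N.
  rewrite -latsum_realZ; apply: ler_sum => k _.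
  exact: le_trans (ler_norm _) (gC _).
lra.
Qed.

(** Obtained by letting N' tend to infinity in [latsum_real_dominated]. The bound depends on g only
    through C, hence is uniform over a dominated family. *)
Lemma latsum_real_tail (g : 'rV[R]_d -> R) C N :
  (forall x, `|g x| <= C * decayd x) ->
  `|limn (latsum_real g) - latsum_real g N| <= C * decay_tail N.
Proof.
move=> gC; have cg := latsum_real_cvg gC.
have c1 : `|latsum_real g N' - latsum_real g N| @[N' --> \oo] -->
    `|limn (latsum_real g) - latsum_real g N|.
  by apply: cvg_norm; apply: cvgB; [exact: cg|exact: cvg_cst].
have c2 : C * (latsum_real decayd N' - latsum_real decayd N) @[N' --> \oo] -->
    C * decay_tail N.
  apply: cvgM; first exact: cvg_cst.
  by apply: cvgB; [exact: latsum_decayd_cvg|exact: cvg_cst].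
rewrite -(cvg_lim _ c1)// -(cvg_lim _ c2)//; apply: ler_lim; [exact: cvgP c1|exact: cvgP c2|].
exists N => // N' /= NN'; rewrite mulrBr -!latsum_realZ.
exact: latsum_real_dominated.
Qed.

(** Tannery's theorem: two tails and one finite sum, each at most e / 3. The bound inherited by [a0]
    is exported because it also yields convergence of the limit series. *)
Lemma latsum_real_lim (a : R -> 'rV[R]_d -> R) (a0 : 'rV[R]_d -> R) C :
  (forall x, a eps x @[eps --> 0^'+] --> a0 x) ->
  (forall eps x, 0 < eps <= 1 -> `|a eps x| <= C * decayd x) ->
  (forall x, `|a0 x| <= C * decayd x) /\
  limn (latsum_real (a eps)) @[eps --> 0^'+] --> limn (latsum_real a0).
Proof.
move=> aa aC.
have near01 : \forall eps \near (0 : R)^'+, 0 < eps <= 1.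
  near=> eps; apply/andP; split; near: eps; first exact: nbhs_right_gt.
  by apply: nbhs_right_le.
have a0C x : `|a0 x| <= C * decayd x.
  have cn : `|a eps x| @[eps --> 0^'+] --> `|a0 x| by exact: cvg_norm.
  rewrite -(cvg_lim _ cn)//.
  apply: limr_le; first exact: cvgP cn.
  by apply: filterS near01 => eps /aC.
split=> //; apply/cvgrPdist_le => e e0.
have e3 : 0 < e / 3 by rewrite divr_gt0.
have [N _ /(_ N (leqnn N)) tN] : \forall N \near \oo, C * decay_tail N <= e / 3.
  have : C * decay_tail N @[N --> \oo] --> 0.
    rewrite -(mulr0 C); apply: cvgM; [exact: cvg_cst|exact: decay_tail_cvg].
  move/cvgrPdist_le/(_ _ e3); apply: filterS => N.
  by rewrite sub0r normrN; apply: le_trans; rewrite ler_norm.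
have fin : latsum_real (a eps) N @[eps --> 0^'+] --> latsum_real a0 N.
  by apply: (cvg_big (op := +%R)) => [|k _]; [exact: add_continuous|exact: aa].
move/cvgrPdist_le/(_ _ e3) : fin => fin.
near=> eps.
have h1 := le_trans (latsum_real_tail N a0C) tN.
have h2 : `|limn (latsum_real (a eps)) - latsum_real (a eps) N| <= e / 3.
  apply: le_trans tN; apply: latsum_real_tail => x; apply: aC.
  by near: eps.
have h3 : `|latsum_real a0 N - latsum_real (a eps) N| <= e / 3 by near: eps.
move: h1 h2 h3; rewrite !ler_norml => /andP[? ?] /andP[? ?] /andP[? ?].
by apply/andP; split; lra.
Unshelve. all: by end_near. Qed.

End Limit.
End LatticeSum.

(** * Uniform decay of the convolution *)

Section TailBound.
Variable R : realType.
Notation lebR := (@lebesgue_measure R).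

(** Since |t - s| >= |t| - M and pi >= 1, the exponential contributes at most eps / (|t| - M)^2;
    divided by sqrt eps from the peak, this leaves one factor sqrt eps. Quadratic decay in t is
    enough for summability over the integers. *)
Lemma gauss_pdf_off (M eps t s : R) : 0 <= M -> 0 < eps -> M + 1 < `|t| -> `|s| <= M ->
  normal_pdf t (gauss_sd eps) s <= Num.sqrt eps / (`|t| - M) ^+ 2.
Proof.
move=> M0 e0 tM sM; rewrite gauss_pdf1E//.
have r0 : 0 < Num.sqrt eps by rewrite sqrtr_gt0.
have re : eps = Num.sqrt eps ^+ 2 by rewrite sqr_sqrtr// ltW.
have v0 : 0 < `|t| - M by lra.
set r := Num.sqrt eps in r0 re *; set v := `|t| - M in v0 *.
have vts : v ^+ 2 <= pi * (t - s) ^+ 2.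
  have h1 : v <= `|t - s|.
    have := ler_normD (t - s) s; rewrite subrK /v => h; lra.
  have h2 : v ^+ 2 <= (t - s) ^+ 2.
    by rewrite -[leRHS]ger0_norm ?sqr_ge0// normrX ler_pXn2r// nnegrE ltW.
  apply: (le_trans h2); rewrite ler_peMl ?sqr_ge0//.
  by rewrite (le_trans _ (pi_ge2 R))// ler1n.
(* exp(-w) <= 1/w for w = pi (t - s)^2 / eps. *)
rewrite mulNr expRN ler_pdivlMr ?exprn_gt0// mulrAC ler_pdivrMr ?expR_gt0//.
rewrite mulrC ler_pdivrMr// mulrAC -expr2 -re.
apply: (le_trans vts); rewrite -ler_pdivrMl//.
by rewrite mulrC (le_trans _ (expR_ge1Dx _))// lerDr.
Qed.

(** The factor 2M is the length of [-M, M], and the added 1 makes the first factor at least 1 for t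
    near the segment. The square bounds (|t| + 1)(|t| + 2): by (M + 3)^2 if |t| <= M + 1, by (M +
    3)^2 (|t| - M)^2 beyond. *)
Definition off_const (M : R) := (M *+ 2 + 1) * (M + 3) ^+ 2.

Lemma off_const_ge (M t : R) : 0 <= M -> `|t| <= M + 1 -> 1 <= off_const M * decay t.
Proof.
move=> M0 tM; have t0 := normr_ge0 t.
have p : 0 < (`|t| + 1) * (`|t| + 2) by rewrite mulr_gt0//; lra.
rewrite /decay ler_pdivlMr// mul1r.
rewrite /off_const; have : (`|t| + 1) * (`|t| + 2) <= (M + 3) ^+ 2.
  by rewrite expr2 ler_pM//; lra.
move=> h; apply: (le_trans h); rewrite ler_peMl ?sqr_ge0//; lra.
Qed.

Lemma off_const_tail (M t : R) : 0 <= M -> M + 1 < `|t| ->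
  M *+ 2 / (`|t| - M) ^+ 2 <= off_const M * decay t.
Proof.
move=> M0 tM; rewrite /decay /off_const; set v := `|t| - M.
have v1 : 1 < v by rewrite /v; lra.
have -> : `|t| = v + M by rewrite /v subrK.
have p : 0 < (v + M + 1) * (v + M + 2) by rewrite mulr_gt0//; lra.
rewrite ler_pdivlMr// mulrAC ler_pdivrMr ?exprn_gt0//; last lra.
have h1 : (v + M + 1) * (v + M + 2) <= (M + 3) ^+ 2 * v ^+ 2.
  rewrite -exprMn expr2 ler_pM//; first lra.
  - lra.
  - have : 0 <= M * (v - 1) by rewrite mulr_ge0//; lra.
    by nra.
  - have : 0 <= M * (v - 1) by rewrite mulr_ge0//; lra.
    by nra.
rewrite -mulrA; apply: ler_pM => //; [by rewrite mulrn_wge0|exact: ltW|lra].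
Qed.

(** Near the segment the total mass 1 is the bound; away from it, the pointwise bound times the
    length 2M. The maximum covers the factors 1 and sqrt eps of the two cases. *)
Lemma gauss_box_integral (M eps t : R) : 0 <= M -> 0 < eps ->
  (\int[lebR]_s (normal_pdf t (gauss_sd eps) s * \1_(`[- M, M]%classic : set R) s)%:E
    <= (Num.max 1 (Num.sqrt eps) * off_const M * decay t)%:E)%E.
Proof.
move=> M0 e0.
have mI : measurable_fun setT (\1_(`[- M, M]%classic) : measurableTypeR R -> R).
  exact: measurable_indic.
have mp := measurable_normal_pdf t (gauss_sd eps).
have max1 : 1 <= Num.max 1 (Num.sqrt eps) by rewrite le_max lexx.
have max2 : Num.sqrt eps <= Num.max 1 (Num.sqrt eps) by rewrite le_max lexx orbT.
have [tM|tM] := leP `|t| (M + 1).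
  apply: (@le_trans _ _ (\int[lebR]_s (normal_pdf t (gauss_sd eps) s)%:E)%E).
    apply: ge0_le_integral => //.
    - by move=> s _; rewrite lee_fin mulr_ge0// normal_pdf_ge0.
    - by apply/measurable_EFinP; exact: measurable_funM.
    - exact/measurable_EFinP.
    - by move=> s _; rewrite lee_fin ler_piMr ?normal_pdf_ge0// indicE lern1 leq_b1.
  rewrite integral_normal_pdf lee_fin -mulrA.
  by have := off_const_ge M0 tM => h; rewrite (le_trans h)// ler_peMl// (le_trans _ h).
apply: (@le_trans _ _ (\int[lebR]_s ((Num.sqrt eps / (`|t| - M) ^+ 2)%:E * (\1_(`[- M, M]%classic : set R) s)%:E))%E).
  apply: ge0_le_integral => //.
  - by move=> s _; rewrite lee_fin mulr_ge0// normal_pdf_ge0.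
  - by apply/measurable_EFinP; exact: measurable_funM.
  - by apply/measurable_EFinP; exact: measurable_funM.
  - move=> s _; rewrite -EFinM lee_fin indicE.
    have [sM|] := boolP (s \in _); last by rewrite !mulr0.
    rewrite !mulr1 gauss_pdf_off//; move: sM; rewrite inE/= in_itv/=.
    by rewrite ler_norml.
have K0 : 0 <= Num.sqrt eps / (`|t| - M) ^+ 2 by rewrite divr_ge0 ?sqrtr_ge0 ?sqr_ge0.
rewrite ge0_integralZl//; last exact/measurable_EFinP.
rewrite integral_indic//= setIT lebesgue_measure_itv/= lte_fin.
have -> : (if - M < M then (M%:E - (- M)%:E)%E else 0%E) = (M *+ 2)%:E.
  case: ltP => [_|]; first by rewrite -EFinB opprK -mulr2n.
  by move=> ?; have -> : M = 0 by [lra]; rewrite mul0rn.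
rewrite -EFinM lee_fin -[leRHS]mulrA mulrAC -mulrA.
have q0 : 0 <= M *+ 2 / (`|t| - M) ^+ 2 by rewrite divr_ge0 ?sqr_ge0 ?mulrn_wge0.
by rewrite ler_pM ?sqrtr_ge0 ?off_const_tail.
Qed.

Variable n : nat.

(** Valid for every eps > 0, which gives convergence of each lattice sum; for eps <= 1 the maximum
    equals 1 and the majorant no longer depends on eps. *)
Lemma conv_real_bound (P : set 'rV[R]_n) (f : 'rV[R]_n -> R) :
  compact P -> {within P, continuous f} -> (forall y, ~ P y -> f y = 0) ->
  exists C, forall eps x, 0 < eps ->
    `|conv_real f eps x| <= C * Num.max 1 (Num.sqrt eps) ^+ n * decayd x.
Proof.
move=> cK fc f0; have [C [M [C0 M0 fCM]]] := box_bounded_extension cK fc f0.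
exists (C * off_const M ^+ n).
move=> eps x e0; rewrite (conv_realE cK fc f0)//.
have mh := measurable_conv_integrand cK fc f0 eps x.
have ih := box_bounded_integrable mh (box_bounded_conv_integrand cK fc f0 x e0).
have fh : (\int[leb R n]_y (f y * gauss eps (x - (y : 'rV[R]_n)))%:E)%E \is a fin_num.
  exact: integrable_fin_num.
set A := Num.max 1 (Num.sqrt eps); set K := off_const M.
pose phi (i : 'I_n) (s : R) := normal_pdf (x ord0 i) (gauss_sd eps) s * \1_(`[- M, M]%classic : set R) s.
have phi0 i s : 0 <= phi i s by rewrite mulr_ge0// normal_pdf_ge0.
have mphi i : measurable_fun [set: measurableTypeR R] (phi i).
  apply: measurable_funM; first exact: measurable_normal_pdf.
  exact: measurable_indic.
(* Each one-dimensional integral is trapped between 0 and a real, hence is a real; the product can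
   then be estimated in R. *)
have Iphi i : exists2 I, 0 <= I <= A * K * decay (x ord0 i) & (\int[lebR]_s (phi i s)%:E)%E = I%:E.
  have I0 : (0 <= \int[lebR]_s (phi i s)%:E)%E by apply: integral_ge0 => s _; rewrite lee_fin.
  have := gauss_box_integral (x ord0 i) M0 e0; rewrite -/(phi i _).
  move: I0; case: (\int[lebR]_s (phi i s)%:E)%E => // I; rewrite !lee_fin => I0 I1.
  by exists I; rewrite ?I0.
have h : (`|\int[leb R n]_y (f y * gauss eps (x - (y : 'rV[R]_n)))%:E| <=
    (C * \prod_(i < n) (A * K * decay (x ord0 i)))%:E)%E.
  apply: (le_trans (le_abse_integral _ measurableT _)); first exact/measurable_EFinP.
  apply: (@le_trans _ _ (\int[leb R n]_y (C%:E * (\prod_(i < n) phi i ((y : 'rV[R]_n) ord0 i))%:E))%E).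
    have mprod : measurable_fun setT (fun y : rvec R n => \prod_(i < n) phi i ((y : 'rV[R]_n) ord0 i)).
      by apply: measurable_prod => i _; exact: (measurableT_comp (mphi i) (@measurable_coord R n i)).
    apply: ge0_le_integral => //.
    - by apply: measurableT_comp => //; exact/measurable_EFinP.
    - by apply/measurable_EFinP; exact: measurable_funM.
    - move=> y _; rewrite -EFinM abse_EFin lee_fin normrM (ger0_norm (gauss_ge0 _ _)).
      rewrite gauss_pdfE// /phi big_split/= mulrCA [leRHS]mulrC [leLHS]mulrC.
      by rewrite mulrC ler_wpM2r// ?fCM// prodr_ge0// => i _; exact: normal_pdf_ge0.
  rewrite ge0_integralZl//; first last.
  - by move=> y _; rewrite lee_fin prodr_ge0.
  - apply/measurable_EFinP; apply: measurable_prod => i _.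
    exact: (measurableT_comp (mphi i) (@measurable_coord R n i)).
  rewrite ge0_integral_prod// EFinM lee_wpmul2l//.
  have /choice[I II] : forall i, exists I, 0 <= I <= A * K * decay (x ord0 i) /\
     (\int[lebR]_s (phi i s)%:E)%E = I%:E by move=> i; have [I] := Iphi i; exists I.
  rewrite (eq_bigr (fun i => (I i)%:E)); last by move=> i _; have [_ ->] := II i.
  by rewrite prodEFin lee_fin; apply: ler_prod => i _; have [] := II i.
move: h; rewrite -(fineK fh) abse_EFin lee_fin => /le_trans; apply.
have -> : \prod_(i < n) (A * K * decay (x ord0 i)) = (A * K) ^+ n * decayd x.
  by rewrite big_split/= prodr_const card_ord.
by rewrite exprMn -!mulrA [K ^+ n * (A ^+ n * _)]mulrCA.
Qed.

(** The two convergence statements are what allows a complex [latsum] to be split into the limits of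
    its real and imaginary parts. *)
Lemma latsum_conv_real (P : set 'rV[R]_n) (f : 'rV[R]_n -> R) :
  compact P -> convex_set_rV P -> {within P, continuous f} ->
  (forall y, ~ P y -> f y = 0) ->
  [/\ forall eps, 0 < eps -> cvgn (latsum_real (conv_real f eps)),
      cvgn (latsum_real (fun x => f x * omega P x)) &
      limn (latsum_real (conv_real f eps)) @[eps --> 0^'+] -->
      limn (latsum_real (fun x => f x * omega P x))].
Proof.
move=> cK cP fc f0; have [C fC] := conv_real_bound cK fc f0.
have [||b lim] := @latsum_real_lim R n (conv_real f) (fun x => f x * omega P x) C.
- by move=> x; exact: conv_real_cvg.
- move=> eps x /andP[e0 e1]; apply: (le_trans (fC eps x e0)).
  rewrite max_l; first by rewrite expr1n mulr1.
  by rewrite -(@sqrtr1 R) ler_wsqrtr.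
split=> //; last exact: latsum_real_cvg b.
by move=> eps e0; apply: latsum_real_cvg => x; exact: fC.
Qed.

End TailBound.

(** * Passage from real to complex values *)

Section Complex.
Variable R : realType.

Lemma normc_le (a b : R) : `|(a +i* b)%C : Cplx R| <= ((`|a| + `|b|)%:C)%C.
Proof.
rewrite [leLHS]normc_def/= lecR -[leRHS]ger0_norm ?addr_ge0// -sqrtr_sqr ler_wsqrtr//.
rewrite sqrrD -!normrX !(ger0_norm (sqr_ge0 _)) lerD2r lerDl.
by rewrite mulrn_wge0// mulr_ge0.
Qed.

Lemma normc_ge_Re (z : Cplx R) : (`|complex.Re z|%:C)%C <= `|z|.
Proof.
by rewrite [leRHS]normc_def/= lecR -sqrtr_sqr ler_wsqrtr// lerDl sqr_ge0.
Qed.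

Lemma normc_ge_Im (z : Cplx R) : (`|complex.Im z|%:C)%C <= `|z|.
Proof.
by rewrite [leRHS]normc_def/= lecR -sqrtr_sqr ler_wsqrtr// lerDr sqr_ge0.
Qed.

Lemma cvg_cplx T (F : set_system T) (FF : Filter F) (a b : T -> R) la lb :
  a @ F --> la -> b @ F --> lb ->
  (fun t => (a t +i* b t)%C : Cplx R) @ F --> ((la +i* lb)%C : Cplx R).
Proof.
move=> /cvgrPdist_lt aF /cvgrPdist_lt bF; apply/cvgrPdist_lt => -[e e'].
(* In the partial order of [R[i]], a positive radius has zero imaginary part, so only real radii
   remain. *)
rewrite ltcE/= => /andP[/eqP -> e0].
have e2 : 0 < e / 2 by rewrite divr_gt0.
move: (aF _ e2) (bF _ e2); apply: filterS2 => t h1 h2.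
apply: (le_lt_trans (normc_le _ _)); rewrite ltcR /=.
by rewrite [ltRHS](splitr e) ltrD.
Qed.

Lemma continuous_Re : continuous (fun z : Cplx R => complex.Re z).
Proof.
move=> z; have FF : Filter (nbhs z) by exact: nbhs_filter.
apply/(@cvgrPdist_lt _ _ _ _ FF) => e e0.
have : \forall w \near z, `|z - w| < (e%:C)%C.
  by move/cvgrPdist_lt : (@cvg_id _ (nbhs z)); apply; rewrite ltcR.
apply: filterS => w; rewrite -ltcR; apply: le_lt_trans.
by rewrite -raddfB; exact: normc_ge_Re.
Qed.

Lemma continuous_Im : continuous (fun z : Cplx R => complex.Im z).
Proof.
move=> z; have FF : Filter (nbhs z) by exact: nbhs_filter.
apply/(@cvgrPdist_lt _ _ _ _ FF) => e e0.
have : \forall w \near z, `|z - w| < (e%:C)%C.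
  by move/cvgrPdist_lt : (@cvg_id _ (nbhs z)); apply; rewrite ltcR.
apply: filterS => w; rewrite -ltcR; apply: le_lt_trans.
by rewrite -raddfB; exact: normc_ge_Im.
Qed.

Lemma latsum_boxE d (g h : 'rV[R]_d -> R) N :
  latsum_box (fun x => (g x +i* h x)%C : Cplx R) N =
  (latsum_real g N +i* latsum_real h N)%C.
Proof.
rewrite /latsum_box /latsum_real.
by elim/big_rec3 : _ => // k a b c _ ->.
Qed.

Lemma latsumE d (g h : 'rV[R]_d -> R) :
  cvgn (latsum_real g) -> cvgn (latsum_real h) ->
  (latsum_box (fun x => (g x +i* h x)%C : Cplx R) N @[N --> \oo] -->
    ((limn (latsum_real g) +i* limn (latsum_real h))%C : Cplx R)) /\
  latsum (fun x => (g x +i* h x)%C : Cplx R) =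
    (limn (latsum_real g) +i* limn (latsum_real h))%C.
Proof.
move=> cg ch.
have H : latsum_box (fun x => (g x +i* h x)%C : Cplx R) N @[N --> \oo] -->
    ((limn (latsum_real g) +i* limn (latsum_real h))%C : Cplx R).
  rewrite (_ : latsum_box _ = fun N => (latsum_real g N +i* latsum_real h N)%C).
    exact: cvg_cplx.
  by apply/funext => N; exact: latsum_boxE.
by split => //; apply/cvg_lim.
Qed.

End Complex.

Theorem theorem6p2 (R : realType) (d : nat) (P : set 'rV[R]_d)
  (f : 'rV[R]_d -> Cplx R) :
  full_dim_polytope P ->
  {within P, continuous f} ->
  (forall x, ~ P x -> f x = 0) ->
  (forall eps : R, 0 < eps ->
     cvg (latsum_box (conv_gauss f eps) N @[N --> \oo])) /\
  (latsum (conv_gauss f eps) @[eps --> 0^'+] -->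
     latsum (fun x => f x * ((omega P x)%:C)%C)).
Proof.
move=> [V [-> _]] fc f0.
have cK := @compact_conv_hull R d V.
have cP : convex_set_rV (conv_hull V) by move=> x y t; exact: conv_hull_segment.
pose fr x := complex.Re (f x); pose fi x := complex.Im (f x).
have frc : {within conv_hull V, continuous fr}.
  by move=> x; apply: (cvg_comp _ _ (fc x)); exact: continuous_Re.
have fic : {within conv_hull V, continuous fi}.
  by move=> x; apply: (cvg_comp _ _ (fc x)); exact: continuous_Im.
have fr0 x : ~ conv_hull V x -> fr x = 0 by move=> /f0; rewrite /fr => ->.
have fi0 x : ~ conv_hull V x -> fi x = 0 by move=> /f0; rewrite /fi => ->.
have [cvr cr limr] := latsum_conv_real cK cP frc fr0.
have [cvi ci limi] := latsum_conv_real cK cP fic fi0.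
split=> [eps e0|].
  by have [H _] := latsumE (cvr _ e0) (cvi _ e0); exact: cvgP H.
have -> : (fun x => f x * ((omega (conv_hull V) x)%:C)%C) =
    (fun x => (fr x * omega (conv_hull V) x +i* (fi x * omega (conv_hull V) x))%C : Cplx R).
  apply/funext => x; rewrite /fr /fi; case: (f x) => a b.
  by apply/eqP; rewrite eq_complex/= !mulr0 subr0 add0r mulrC eqxx mulrC eqxx.
have [_ ->] := latsumE cr ci.
apply: cvg_trans (cvg_cplx _ limr limi).
(* The splitting of [latsum] is known for eps > 0 only, hence an equality near 0 from the right. *)
apply: near_eq_cvg; near=> eps.
have e0 : 0 < eps by near: eps; exact: nbhs_right_gt.
by have [_ ->] := latsumE (cvr _ e0) (cvi _ e0).
Unshelve. all: by end_near. Qed.
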